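(* Let $1<p,q<\infty$ with $1/p+1/q\leq 1$, and let $1\leq r<\infty$ be defined by $1/p+1/q=1/r$. Let $X,Y,Z,E,F$ be Banach spaces such that $Z^*$ is a subspace of $\mathcal{UM}(E^*,F)$. Let $U$ be a subspace of $\mathcal{UM}(X^*,Y)$ and let $S:U\to Z$ be an operator. Consider the following statements: (i) $S$ is $(\ell^s_p,\ell^s_q)$-dominated. (ii) There exist a constant $K\geq 0$ and measures $\mu\in P(B_{X^*})$ and $\eta\in P(B_{E^*})$ such that $$|\langle S(T),z^*\rangle|\leq K\Big(\int_{B_{X^*}}\|T(\cdot)\|_Y^p\,d\mu\Big)^{1/p}\cdot\Big(\int_{B_{E^*}}\|z^*(\cdot)\|_F^q\,d\eta\Big)^{1/q}$$ for every $T\in U\cap X\epsilon Y$ and every $z^*\in Z^*\cap E\epsilon F$. (iii) There exist a constant $K\geq 0$ and measures $\mu\in P(B_{X^*})$ and $\eta\in P(B_{E^*})$ such that the inequality displayed in (ii) holds for every $T\in U$ and every $z^*\in Z^*$. (iv) There exist a Banach space $W$, an $(\ell^s_p,\ell_p)$-controlled operator $S_2:U\to W$ and an operator $S_1:W\to Z$ with $(\ell^s_q,\ell_q)$-controlled adjoint such that $S=S_1\circ S_2$. (v) There exist a Banach space $W$, an $(\ell^s_p,\ell_p)$-summing operator $S_2:U\to W$ and an operator $S_1:W\to Z$ with $(\ell^s_q,\ell_q)$-summing adjoint such that $S=S_1\circ S_2$. Then (iii)$\Rightarrow$(iv)$\Rightarrow$(v)$\Rightarrow$(i)$\Rightarrow$(ii).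 All statements (i)--(v) are equivalent if, in addition, we assume that: (a) the identity map on $Z^*$ is (SOT-to-$w^*$) sequentially continuous; (b) $Z^*\cap E\epsilon F$ is SOT-sequentially dense in $Z^*$; (c) $U\cap X\epsilon Y$ is SOT-sequentially dense in $U$; (d) $S$ is (SOT-to-norm) sequentially continuous.
   Context: All Banach spaces are real. ''Subspace'' of a Banach space means norm-closed linear subspace; ''operator'' means continuous linear map between Banach spaces. For a Banach space $X$, $B_{X^*}$ is the closed unit ball of the dual $X^*$, equipped with the weak$^*$-topology (a compact space), and $P(B_{X^*})$ is the set of regular Borel probability measures on $(B_{X^*},w^* )$. $\mathcal{L}(X^*,Y)$ is the Banach space of all operators from $X^*$ to $Y$ with the operator norm. $X\epsilon Y$ is the subspace of all $T\in\mathcal{L}(X^*,Y)$ whose restriction $T|_{B_{X^*}}$ is ($w^*$-to-norm) continuous. $\mathcal{UM}(X^*,Y)$ is the subspace of all $T\in\mathcal{L}(X^*,Y)$ such that $T|_{B_{X^*}}$ is universally strongly measurable, i.e. strongly $\mu$-measurable (a $\mu$-a.e. norm limit of a sequence of $\mu$-measurable simple functions) for every $\mu\in P(B_{X^*})$. The spaces $E\epsilon F$ and $\mathcal{UM}(E^*,F)$ are defined in the same way with $E,F$ in place of $X,Y$. Saying that $Z^*$ is a subspace of $\mathcal{UM}(E^*,F)$ means that the dual Banach space $Z^*$ is identified (with its norm) with a norm-closed linear subspace of $\mathcal{UM}(E^*,F)$; thus each $z^*\in Z^*$ is also an operator $z^*:E^*\to F$, and the adjoint $S_1^*:Z^*\to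 W^*$ of an operator $S_1:W\to Z$ is an operator defined on a subspace of $\mathcal{UM}(E^*,F)$. On $Z^*$, $w^*$ denotes the weak$^*$-topology as the dual of $Z$, and SOT is the topology inherited from $\mathcal{L}(E^*,F)$. The strong operator topology (SOT) on $\mathcal{L}(X^*,Y)$ is the topology of pointwise norm convergence: $T_\alpha\to 0$ in SOT iff $\|T_\alpha(x^* )\|_Y\to 0$ for every $x^*\in X^*$. A map is (SOT-to-$\tau$) sequentially continuous if it sends SOT-convergent sequences (with limit in the domain) to sequences $\tau$-converging to the image of the limit. A set $A\subseteq V$ is SOT-sequentially dense in $V$ if every element of $V$ is the SOT-limit of a sequence in $A$. Let $1\leq s<\infty$ and let $V$ be a Banach space. For a subspace $U\subseteq\mathcal{L}(X^*,Y)$, an operator $R:U\to V$ is $(\ell^s_s,\ell_s)$-summing with exponent $s$ (written $(\ell^s_p,\ell_p)$-summing when the exponent is $p$, and $(\ell^s_q,\ell_q)$-summing when it is $q$; the superscript $s$ in $\ell^s_p,\ell^s_q$ is only a symbol standing for ''strong'') if there is $K\geq 0$ such that $$\Big(\sum_{i=1}^n\|R(T_i)\|_V^s\Big)^{1/s}\leq K\sup_{x^*\in B_{X^*}}\Big(\sum_{i=1}^n\|T_i(x^* )\|_Y^s\Big)^{1/s}$$ for all $n\in\mathbb{N}$ and $T_1,\dots,T_n\in U$. If $U\subseteq\mathcal{UM}(X^*,Y)$, then $R:U\to V$ is controlled with exponent $s$ (written $(\ell^s_p,\ell_p)$-controlled for exponent $p$, $(\ell^s_q,\ell_q)$-controlled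 for exponent $q$) if there exist $K\geq 0$ and $\mu\in P(B_{X^*})$ such that $\|R(T)\|_V\leq K\big(\int_{B_{X^*}}\|T(\cdot)\|_Y^s\,d\mu\big)^{1/s}$ for every $T\in U$. The same definitions apply to operators defined on subspaces of $\mathcal{UM}(E^*,F)$, with $E,F$ in place of $X,Y$. For a subspace $U\subseteq\mathcal{L}(X^*,Y)$, an operator $S:U\to Z$ is $(\ell^s_p,\ell^s_q)$-dominated if there is $K\geq 0$ such that $$\Big(\sum_{i=1}^n|\langle S(T_i),z_i^*\rangle|^r\Big)^{1/r}\leq K\sup_{x^*\in B_{X^*}}\Big(\sum_{i=1}^n\|T_i(x^* )\|_Y^p\Big)^{1/p}\cdot\sup_{e^*\in B_{E^*}}\Big(\sum_{i=1}^n\|z_i^*(e^* )\|_F^q\Big)^{1/q}$$ for all $n\in\mathbb{N}$, $T_1,\dots,T_n\in U$ and $z_1^*,\dots,z_n^*\in Z^*$. *)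

(* Defs.v *)
From HB Require Import structures.
From mathcomp Require Import all_boot all_order all_algebra.
From mathcomp Require Import all_classical all_reals all_analysis.
From mathcomp Require Import measurable_realfun.

Set Implicit Arguments.
Unset Strict Implicit.
Unset Printing Implicit Defensive.

Import Order.TTheory GRing.Theory Num.Theory.
Import numFieldNormedType.Exports.

Local Open Scope classical_set_scope.
Local Open Scope ring_scope.

Definition unit_ball (R : realType) (V : normedModType R) : set V :=
  [set x | `|x| <= 1].

Definition is_operator (R : realType) (V W : normedModType R) :
  {pred V -> W} := mem [set f : V -> W | linear f /\ continuous f].

Record operator (R : realType) (V W : normedModType R) := Operator {
  operator_fun :> V -> W;
  operatorP : operator_fun \in @is_operator R V W }.

Section OperatorSpace.
Variables (R : realType) (V W : normedModType R).

HB.instance Definition _ := [isSub for @operator_fun R V W].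
HB.instance Definition _ := [Choice of operator V W by <:].

Lemma operator_linear (f : operator V W) : linear f.
Proof. by have /set_mem[] := operatorP f. Qed.

Lemma operator_continuous (f : operator V W) : continuous f.
Proof. by have /set_mem[] := operatorP f. Qed.

HB.instance Definition _ (f : operator V W) :=
  GRing.isLinear.Build R V W _ f (operator_linear f).

Let operator_submod_closed : submod_closed (@is_operator R V W).
Proof.
split=> [|a f g /set_mem[fl fc] /set_mem[gl gc]]; apply/mem_set.
  by split=> [b x y|x]; [rewrite /= scaler0 addr0|exact: cvg_cst].
split=> [b x y|x].
  have E z : (a *: f + g) z = a *: f z + g z by [].
  by rewrite !E fl gl !scalerDr !scalerA (mulrC a b) addrACA.
by apply: cvgD; [apply: cvgZr; exact: fc|exact: gc].
Qed.

HB.instance Definition _ :=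
  GRing.isSubmodClosed.Build R (V -> W) (@is_operator R V W)
    operator_submod_closed.
HB.instance Definition _ := [SubChoice_isSubLmodule of operator V W by <:].

Definition operator_norm (f : operator V W) : R :=
  sup [set `|f x| | x in @unit_ball R V].

Lemma operator_bounded (f : operator V W) :
  exists M : R, forall x, `|f x| <= M * `|x|.
Proof.
have /linear_bounded_continuous/linear_boundedP := @operator_continuous f.
by move=> [M [_ /(_ (M + 1))]]; rewrite ltrDl ltr01 => /(_ isT) ?; exists (M + 1).
Qed.

Lemma operator_norm_has_sup (f : operator V W) :
  has_sup [set `|f x| | x in @unit_ball R V].
Proof.
split; first by exists `|f 0|, 0 => //; rewrite /unit_ball/= normr0.
have [M fM] := operator_bounded f; exists `|M| => _ [x x1 <-].
rewrite (le_trans (fM x))// (le_trans (ler_wpM2r _ (ler_norm M)))//.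
by rewrite ler_piMr.
Qed.

Lemma operator_norm_ge0 (f : operator V W) : 0 <= operator_norm f.
Proof.
apply: le_trans (normr_ge0 (f 0)) _.
apply: sup_upper_bound; first exact: operator_norm_has_sup.
by exists 0 => //; rewrite /unit_ball/= normr0.
Qed.

Lemma operator_norm_le (f : operator V W) x : `|f x| <= operator_norm f * `|x|.
Proof.
have [->|x0] := eqVneq x 0; first by rewrite linear0 !normr0 mulr0.
have nx : 0 < `|x| by rewrite normr_gt0.
rewrite -ler_pdivrMr// mulrC -[X in X * _](@ger0_norm _ `|x|^-1) ?invr_ge0//.
rewrite -normrZ -linearZ; apply: sup_upper_bound.
  exact: operator_norm_has_sup.
exists (`|x|^-1 *: x) => //.
by rewrite /unit_ball/= normrZ ger0_norm ?invr_ge0// mulVf// gt_eqF.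
Qed.

Lemma operator_norm_lub (f : operator V W) (M : R) :
  (forall x, `|x| <= 1 -> `|f x| <= M) -> operator_norm f <= M.
Proof.
move=> fM; apply: ge_sup; first by case: (operator_norm_has_sup f).
by move=> _ [x x1 <-]; exact: fM.
Qed.

Let operator_normD (f g : operator V W) :
  operator_norm (f + g) <= operator_norm f + operator_norm g.
Proof.
apply: operator_norm_lub => x x1; apply: (le_trans (ler_normD _ _)).
by apply: lerD; apply: (le_trans (operator_norm_le _ _));
  rewrite ler_piMr// operator_norm_ge0.
Qed.

Let operator_normZ_le (l : R) (f : operator V W) :
  operator_norm (l *: f) <= `|l| * operator_norm f.
Proof.
apply: operator_norm_lub => x x1; rewrite [leLHS]normrZ ler_wpM2l//.
by apply: (le_trans (operator_norm_le _ _)); rewrite ler_piMr// operator_norm_ge0.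
Qed.

Let operator_normZ (l : R) (f : operator V W) :
  operator_norm (l *: f) = `|l| * operator_norm f.
Proof.
apply/eqP; rewrite eq_le operator_normZ_le/=.
have [->|l0] := eqVneq l 0; first by rewrite normr0 mul0r operator_norm_ge0.
rewrite -ler_pdivlMl ?normr_gt0// -normfV.
by rewrite (le_trans _ (operator_normZ_le _ _))// scalerA mulVf// scale1r.
Qed.

Let operator_norm0_eq0 (f : operator V W) : operator_norm f = 0 -> f = 0.
Proof.
move=> f0; apply/val_inj/funext => x /=; apply/normr0_eq0/le_anti.
by rewrite normr_ge0 (le_trans (operator_norm_le _ _))// f0 mul0r.
Qed.

HB.instance Definition _ := Lmodule_isNormed.Build R (operator V W)
  operator_normD operator_normZ operator_norm0_eq0.

End OperatorSpace.

Definition dual (R : realType) (V : normedModType R) : normedModType R :=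
  operator V R^o.

Section Adjoint.
Variables (R : realType) (V W : normedModType R).

Let adjoint_funP (S : operator V W) (f : dual W) :
  (f \o S : V -> R^o) \in @is_operator R V R^o.
Proof.
apply/mem_set; split=> [a x y|x]; first by rewrite /= !linearP.
by apply: continuous_comp; exact: operator_continuous.
Qed.

Let adjoint_op (S : operator V W) (f : dual W) : dual V :=
  Operator (adjoint_funP S f).

Let adjointP (S : operator V W) :
  (adjoint_op S : dual W -> dual V) \in @is_operator R (dual W) (dual V).
Proof.
have lS : linear (adjoint_op S) by move=> a f g; exact/val_inj.
pose L := GRing.isLinear.Build R (dual W) (dual V) _ (adjoint_op S) lS.
pose F : {linear dual W -> dual V} := HB.pack (adjoint_op S) L.
apply/mem_set; split=> //.
apply: (@bounded_linear_continuous _ _ _ F); apply/linear_boundedP.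
exists `|S|; split=> // r Sr f; apply: operator_norm_lub => x x1 /=.
apply: (le_trans (operator_norm_le f _)); rewrite mulrC ler_wpM2r ?operator_norm_ge0//.
apply: (le_trans (operator_norm_le S x)); apply: le_trans (ltW Sr).
by apply: ler_piMr => //; exact: operator_norm_ge0.
Qed.

Definition adjoint (S : operator V W) : operator (dual W) (dual V) :=
  Operator (adjointP S).

End Adjoint.

Record closedSubspace (R : realType) (V : normedModType R) := ClosedSubspace {
  subspace_set : set V;
  subspace_submod : submod_closed (mem subspace_set);
  subspace_closed : closed subspace_set }.

Definition subspace_pred (R : realType) (V : normedModType R)
  (U : closedSubspace V) : {pred V} := mem (subspace_set U).

Record subspace_sort (R : realType) (V : normedModType R)
  (U : closedSubspace V) := SubspaceSort {
  subspace_val :> V;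
  subspace_valP : subspace_val \in subspace_pred U }.

Section SubspaceSort.
Variables (R : realType) (V : normedModType R) (U : closedSubspace V).

HB.instance Definition _ := [isSub for @subspace_val R V U].
HB.instance Definition _ := [Choice of subspace_sort U by <:].
HB.instance Definition _ :=
  GRing.isSubmodClosed.Build R V (subspace_pred U) (subspace_submod U).
HB.instance Definition _ := [SubChoice_isSubLmodule of subspace_sort U by <:].

Let subspace_norm (x : subspace_sort U) : R := `|subspace_val x|.

Let subspace_normD x y :
  subspace_norm (x + y) <= subspace_norm x + subspace_norm y.
Proof. exact: ler_normD. Qed.

Let subspace_normZ (l : R) x : subspace_norm (l *: x) = `|l| * subspace_norm x.
Proof. exact: normrZ. Qed.

Let subspace_norm0_eq0 x : subspace_norm x = 0 -> x = 0.
Proof. by move=> /normr0_eq0 x0; exact: val_inj. Qed.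

HB.instance Definition _ := Lmodule_isNormed.Build R (subspace_sort U)
  subspace_normD subspace_normZ subspace_norm0_eq0.

End SubspaceSort.

Coercion subspace_space (R : realType) (V : normedModType R)
  (U : closedSubspace V) : normedModType R := subspace_sort U.

Definition sot (R : realType) (V W : normedModType R) : topologicalType :=
  initial_topology (@operator_fun R V W : operator V W -> {ptws V -> W}).

(* The weak* topology is the topology of pointwise convergence, that is, the
   strong operator topology of the operators into the scalars. *)
Definition wstar (R : realType) (X : normedModType R) : topologicalType :=
  sot X R^o.

Definition dual_ball (R : realType) (X : normedModType R) : Type :=
  set_type (@unit_ball R (dual X) : set (wstar X)).

Section DualBall.
Variables (R : realType) (X : normedModType R).

HB.instance Definition _ := Topological.copy (dual_ball X)
  (set_type (@unit_ball R (dual X) : set (wstar X))).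

Definition ball_incl (x : dual_ball X) : dual X := \val x.

Let unit_ball0 : (0 : dual X) \in @unit_ball R (dual X).
Proof. by apply/mem_set; rewrite /unit_ball/= normr0. Qed.

HB.instance Definition _ :=
  isPointed.Build (dual_ball X)
  (@exist _ (fun x : dual X => x \in @unit_ball R (dual X)) _ unit_ball0).

Definition borel_ball := g_sigma_algebraType (@open (dual_ball X)).

HB.instance Definition _ := Measurable.on borel_ball.

End DualBall.

Definition regular_probability (R : realType) (X : normedModType R)
    (mu : probability (borel_ball X) R) : Prop :=
  forall A : set (borel_ball X), measurable A ->
    mu A = ereal_inf [set mu O | O in
             [set O : set (dual_ball X) | open O /\ A `<=` O]] /\
    mu A = ereal_sup [set mu C | C in
             [set C : set (dual_ball X) | compact C /\ C `<=` A]].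

(* A set is [mu]-measurable when it differs from a measurable set by a
   [mu]-negligible one. *)
Definition mu_simple d (T : measurableType d) (R : realType) (Y : Type)
    (mu : {measure set T -> \bar R}) (g : T -> Y) : Prop :=
  finite_set (range g) /\
  forall y : Y, completed_algebra_gen mu (g @^-1` [set y]).

Definition strongly_measurable d (T : measurableType d) (R : realType)
    (Y : normedModType R) (mu : {measure set T -> \bar R}) (f : T -> Y) : Prop :=
  exists g : nat -> T -> Y,
    (forall n, mu_simple mu (g n)) /\
    {ae mu, forall t, g n t @[n --> \oo] --> f t}.

Definition UM (R : realType) (X Y : normedModType R) :
    set (operator (dual X) Y) :=
  [set T : operator (dual X) Y |
     forall mu : probability (borel_ball X) R, regular_probability mu ->
     strongly_measurable mu (fun x : borel_ball X => T (ball_incl x))].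

Definition eps_product (R : realType) (X Y : normedModType R) :
    set (operator (dual X) Y) :=
  [set T : operator (dual X) Y |
     continuous (fun x : dual_ball X => T (ball_incl x))].

(* The supremum is over a nonempty bounded set. *)
Definition strong_sup (R : realType) (X Y : normedModType R) (s : R) (n : nat)
    (T : 'I_n -> operator (dual X) Y) : R :=
  sup [set (\sum_(i < n) `|T i x| `^ s) `^ s^-1 | x in @unit_ball R (dual X)].

(* For [T] in [UM X Y] the integrand is bounded and measurable for the
   completion of [mu] only; on nonnegative functions the library integral is the
   supremum over the measurable simple functions below the integrand, so that
   it computes the integral with respect to the completion. *)
Definition strong_mean (R : realType) (X Y : normedModType R) (s : R)
    (mu : probability (borel_ball X) R) (T : operator (dual X) Y) : R :=
  (\int[mu]_(x in [set: borel_ball X]) (`|T (ball_incl x)| `^ s)) `^ s^-1.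

Section OperatorClasses.
Variables (R : realType) (X Y U V : normedModType R).
(* [j] is the embedding that views elements of [U] as operators. *)
Variables (j : U -> operator (dual X) Y) (s : R).

Definition summing (Q : operator U V) : Prop :=
  exists2 K : R, 0 <= K & forall (n : nat) (T : 'I_n -> U),
    (\sum_(i < n) `|Q (T i)| `^ s) `^ s^-1 <= K * strong_sup s (j \o T).

Definition controlled (Q : operator U V) : Prop :=
  exists2 K : R, 0 <= K &
  exists2 mu : probability (borel_ball X) R, regular_probability mu &
    forall T : U, `|Q T| <= K * strong_mean s mu (j T).

End OperatorClasses.

Definition dominated (R : realType) (X Y Z E F : normedModType R)
    (U : closedSubspace (operator (dual X) Y))
    (j : dual Z -> operator (dual E) F) (p q r : R) (S : operator U Z) : Prop :=
  exists2 K : R, 0 <= K &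
    forall (n : nat) (T : 'I_n -> U) (z : 'I_n -> dual Z),
      (\sum_(i < n) `|(z i : operator Z R^o) (S (T i))| `^ r) `^ r^-1 <=
      K * strong_sup p (fun i => subspace_val (T i)) * strong_sup q (j \o z).

Definition sot_seq_dense (R : realType) (V W : normedModType R)
    (A B : set (operator V W)) : Prop :=
  forall T, B T -> exists2 u : nat -> operator V W,
    (forall n, A (u n)) & (u : nat -> sot V W) n @[n --> \oo] --> (T : sot V W).

(* Here [U] is viewed inside the operators from [V] to [W] through [j]. *)
Definition sot_seq_continuous (R : realType) (V W U : normedModType R)
    (T : topologicalType) (j : U -> operator V W) (f : U -> T) : Prop :=
  forall (u : nat -> U) (l : U),
    (j (u n) : sot V W) @[n --> \oo] --> (j l : sot V W) ->
    f (u n) @[n --> \oo] --> f l.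

(* Main.v *)
Require Import Defs.
From HB Require Import structures.
From mathcomp Require Import all_boot all_order all_algebra.
From mathcomp Require Import all_classical all_reals all_analysis.
From mathcomp Require Import measurable_realfun.
From mathcomp Require Import ring lra.

(** The implications (iii) => (iv) => (v) => (i) => (ii) form a circle that the
    density and continuity assumptions close by (ii) => (iii).

    (i) => (ii) is a Pietsch domination theorem. Take [r]-th powers in the domination
    inequality and apply Young's inequality to the product of the two suprema: every
    finite sum of the functions
      [(x, e) |-> K^r (r/p |T x|^p + r/q |z e|^q) - |<S T, z>|^r]
    on the product of the two dual balls has a nonnegative supremum
    ([slack_cone_sup_ge0]). These functions generate a convex cone, because
    [1/p + 1/q = 1/r] makes them homogeneous ([slackZ]), so the Hahn-Banach theorem
    ([hahn_banach_cone], proved with minimal sublinear functionals) yields a mean on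
    the bounded functions of the product that is nonnegative on the cone
    ([mean_ge0_cone], [dominated_mean]). Its two marginals are means on the dual balls.
    A mean gives a finitely additive probability, and on a compact Hausdorff space
    such a set function is dominated on closed sets by a Radon probability
    ([radon_majorant]): take suprema over closed subsets of open sets, infima over
    open supersets, and apply Caratheodory's theorem. Domination on closed sets is
    enough to bound the mean of a nonnegative continuous function by its integral
    ([mean_le_integral]), and dual balls are compact ([dual_ball_compact]). This is
    where continuity of [T] and [z] on the balls enters. Replacing [T], [z] by
    [t T], [t^-1 z] and optimizing over [t] ([young_optimal]) turns the sum of two
    integrals into the product in (ii).

    (ii) => (iii): by density, [T] and [z] are pointwise limits of sequences of
    operators to which (ii) applies. Such a sequence is bounded by the uniform
    boundedness principle ([sot_cvg_bounded]), so dominated convergence lets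
    both integrals pass to the limit ([strong_mean_cvg]).

    (iii) => (iv): the intermediate space is not a completion of [U] but a subspace of
    [Z] with a finer norm, namely the elements [w] such that [|<w, z>|] is bounded by
    a multiple of the [L^q] mean of [z] ([gauge_space]). The adjoint of its inclusion
    into [Z] is controlled by definition of the norm, and (iii) says that [S] maps
    into it in a controlled way ([pietsch_factorization]).

    (iv) => (v) integrates a finite sum of powers ([controlled_summing]), and
    (v) => (i) is Hoelder's inequality for finite sums
    ([summing_factorization_dominated]). *)

Set Implicit Arguments.
Unset Strict Implicit.
Unset Printing Implicit Defensive.

Import Order.TTheory GRing.Theory Num.Theory.
Import numFieldNormedType.Exports.

Local Open Scope classical_set_scope.
Local Open Scope ring_scope.

(** * Bounded linear maps and the Hahn-Banach theorem *)

Lemma bounded_is_operator (R : realType) (V W : normedModType R) (f : V -> W)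
    (M : R) : linear f -> (forall x, `|f x| <= M * `|x|) ->
  f \in @is_operator R V W.
Proof.
move=> fl fM; pose Lm := GRing.isLinear.Build R V W _ f fl.
pose L : {linear V -> W} := HB.pack f Lm.
apply/mem_set; split=> //; apply: (@bounded_linear_continuous _ _ _ L).
apply/linear_boundedP; exists M; split=> [|r Mr x]; first exact: num_real.
by apply: (le_trans (fM x)); rewrite ler_wpM2r// ltW.
Qed.

Section HahnBanach.
Variables (R : realType) (V : lmodType R).
Implicit Types (s t : V -> R) (G : set (V * R)).

Definition sublinear s : Prop :=
  (forall x y, s (x + y) <= s x + s y) /\
  (forall a x, 0 <= a -> s (a *: x) = a * s x).

Lemma sublinear0 s : sublinear s -> s 0 = 0.
Proof. by move=> [_ sZ]; rewrite -[X in s X](scale0r 0) sZ// mul0r. Qed.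

Lemma sublinear_geN s : sublinear s -> forall x, - s (- x) <= s x.
Proof.
move=> ss x; have [sD _] := ss.
by have := sD x (- x); rewrite subrr sublinear0//; lra.
Qed.

Definition convex_cone G : Prop :=
  [/\ G (0, 0), (forall f g, G f -> G g -> G (f + g)) &
     forall a f, 0 < a -> G f -> G (a *: f.1, a * f.2)].

(** A linear functional [L] lies below [cone_inf s G] exactly when [L <= s] and
    [f.2 <= L f.1] for all [f] in the cone [G]. *)
Definition cone_inf s G (x : V) : R := inf [set s (x + f.1) - f.2 | f in G].

Section ConeInf.
Variables (s : V -> R) (G : set (V * R)).
Hypotheses (ss : sublinear s) (cG : convex_cone G).
Hypothesis Gs : forall f, G f -> f.2 <= s f.1.

Lemma cone_inf_has_inf x : has_inf [set s (x + f.1) - f.2 | f in G].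
Proof.
have [G0 _ _] := cG; have [sD _] := ss; split.
  by exists (s (x + 0) - 0), (0, 0).
exists (- s (- x)) => _ [f Gf <-]; have := Gs Gf.
by have := sD (x + f.1) (- x); rewrite addrAC subrr add0r; lra.
Qed.

Lemma cone_inf_le x f : G f -> cone_inf s G x <= s (x + f.1) - f.2.
Proof.
move=> Gf; apply: ge_inf; first by case: (cone_inf_has_inf x).
by exists f.
Qed.

Lemma le_cone_inf x c :
  (forall f, G f -> c <= s (x + f.1) - f.2) -> c <= cone_inf s G x.
Proof.
move=> H; apply: lb_le_inf; first by case: (cone_inf_has_inf x).
by move=> _ [f Gf <-]; exact: H.
Qed.

Lemma cone_inf_sublinear : sublinear (cone_inf s G).
Proof.
have [G0 GD GZ] := cG; have [sD sZ] := ss.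
have D x y : cone_inf s G (x + y) <= cone_inf s G x + cone_inf s G y.
  rewrite -lerBlDr; apply: le_cone_inf => f Gf.
  rewrite lerBlDr -lerBlDl; apply: le_cone_inf => g Gg.
  have := cone_inf_le (x + y) (GD _ _ Gf Gg) => /=.
  by have := sD (x + f.1) (y + g.1); rewrite addrACA; lra.
have Z a x : 0 < a -> cone_inf s G (a *: x) <= a * cone_inf s G x.
  move=> a0; rewrite mulrC -ler_pdivrMr//; apply: le_cone_inf => f Gf.
  rewrite ler_pdivrMr//; have := cone_inf_le (a *: x) (GZ _ _ a0 Gf) => /=.
  by rewrite -scalerDr sZ ?(ltW a0)//; lra.
split=> // a x; rewrite le_eqVlt => /predU1P[<-|a0]; last first.
  apply/eqP; rewrite eq_le Z//= -ler_pdivlMl//.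
  by have := Z a^-1 (a *: x); rewrite invr_gt0 scalerA mulVf ?gt_eqF// scale1r; apply.
rewrite scale0r mul0r; apply/eqP; rewrite eq_le; apply/andP; split.
  by have := cone_inf_le 0 G0; rewrite /= addr0 subr0 (sublinear0 ss).
by apply: le_cone_inf => f /Gs; rewrite add0r; lra.
Qed.

End ConeInf.

(** Infima of chains stay finite because any sublinear [s] below [p] satisfies
    [s x >= - s (- x) >= - p (- x)]. *)
Lemma minimal_sublinear p : sublinear p -> exists s,
  [/\ sublinear s, forall x, s x <= p x &
      forall t, sublinear t -> (forall x, t x <= s x) -> t = s].
Proof.
move=> sp; pose T := {s | sublinear s /\ forall x, s x <= p x}.
pose le (s t : T) := `[< forall x, sval t x <= sval s x >].
have [| | | |s smin] := @Zorn T le.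
- by move=> t; apply/asboolP.
- move=> r s t /asboolP rs /asboolP st; apply/asboolP => x.
  exact: le_trans (st x) (rs x).
- move=> [s Ps] [t Pt] /asboolP /= st /asboolP /= ts; apply: eq_exist.
  by apply/funext => x; apply/eqP; rewrite eq_le ts st.
- move=> A Atot; have [[s0 As0]|A0] := pselect (exists s : T, A s); last first.
    have Pp : sublinear p /\ forall x, p x <= p x by [].
    by exists (exist _ p Pp) => s As; exfalso; apply: A0; exists s.
  pose t x := inf [set sval (s : T) x | s in A].
  have hi x : has_inf [set sval (s : T) x | s in A].
    split; first by exists (sval s0 x), s0.
    exists (- p (- x)) => _ [[s [ss sp']] _ <-] /=.
    by apply: le_trans (sublinear_geN ss x); rewrite lerN2.
  have tle (s : T) x : A s -> t x <= sval s x.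
    by move=> As; apply: ge_inf; [case: (hi x)|exists s].
  have tge c x : (forall s : T, A s -> c <= sval s x) -> c <= t x.
    move=> H; apply: lb_le_inf; first by case: (hi x).
    by move=> _ [s As <-]; exact: H.
  have st : sublinear t.
    split=> [x y|a x a0].
      rewrite -lerBlDr; apply: (tge _ x) => s As; rewrite lerBlDr -lerBlDl.
      apply: (tge _ y) => u Au; rewrite lerBlDl.
      have [[su _] [uu _]] := ((svalP s).1, (svalP u).1).
      have [/asboolP us|/asboolP us] := Atot _ _ As Au.
        apply: (le_trans (tle _ _ Au)); apply: (le_trans (uu _ _)).
        by rewrite lerD2r.
      apply: (le_trans (tle _ _ As)); apply: (le_trans (su _ _)).
      by rewrite lerD2l.
    move: a0; rewrite le_eqVlt => /predU1P[<-|a0].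
      rewrite scale0r mul0r /t [X in inf X](_ : _ = [set 0]) ?inf1//.
      apply/seteqP; split=> [_ [s As <-]|_ ->]/=.
        by rewrite sublinear0//; exact: (svalP s).1.
      by exists s0 => //; rewrite sublinear0//; exact: (svalP s0).1.
    apply/eqP; rewrite eq_le; apply/andP; split.
      rewrite mulrC -ler_pdivrMr//; apply: tge => s As.
      rewrite ler_pdivrMr// mulrC -(svalP s).1.2 ?(ltW a0)//; exact: tle.
    apply: tge => s As; rewrite (svalP s).1.2 ?(ltW a0)// ler_pM2l//.
    exact: tle.
  have Pt : sublinear t /\ forall x, t x <= p x.
    split=> // x; exact: le_trans (tle _ _ As0) ((svalP s0).2 x).
  by exists (exist _ t Pt) => s As; apply/asboolP => x; exact: tle.
exists (sval s); have [ss sp'] := svalP s; split=> // t st ts.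
have Pt : sublinear t /\ forall x, t x <= p x.
  by split=> // x; exact: le_trans (sp' x).
by have := smin (exist _ t Pt); move=> <-//; apply/asboolP.
Qed.

(** A sublinear [s] can be lowered along the ray through [y] unless
    [s (- y) = - s y], so minimality forces [s] to be odd, hence linear. *)
Lemma minimal_sublinear_linear s : sublinear s ->
  (forall t, sublinear t -> (forall x, t x <= s x) -> t = s) ->
  linear (s : V -> R^o).
Proof.
move=> ss smin; have [sD sZ] := ss.
have sN y : s (- y) = - s y.
  pose G : set (V * R) := [set (a *: y, a * s y) | a in [set a | 0 <= a]].
  have G1 : G (y, s y) by exists 1; rewrite /= ?ler01 ?scale1r ?mul1r.
  have cG : convex_cone G.
    split=> [|_ _ [a a0 <-] [b b0 <-]|b _ b0 [a a0 <-]].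
    - by exists 0; rewrite /= ?lexx ?scale0r ?mul0r.
    - by exists (a + b); rewrite /= ?addr_ge0// scalerDl mulrDl.
    - by exists (b * a); rewrite /= ?mulr_ge0 ?(ltW b0)// scalerA mulrA.
  have Gs f : G f -> f.2 <= s f.1 by move=> [a a0 <-] /=; rewrite sZ.
  have /smin : sublinear (cone_inf s G) by exact: cone_inf_sublinear.
  have [G0 _ _] := cG => /(_ _)/[dup] E <-; last first.
    by move=> x; have := cone_inf_le ss cG Gs x G0; rewrite /= addr0 subr0.
  apply/eqP; rewrite eq_le; apply/andP; split; last first.
    rewrite lerNl E; first exact: sublinear_geN.
    by move=> x; have := cone_inf_le ss cG Gs x G0; rewrite /= addr0 subr0.
  have := cone_inf_le ss cG Gs (- y) G1.
  rewrite /= addNr sublinear0// E; first by rewrite sub0r.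
  by move=> x; have := cone_inf_le ss cG Gs x G0; rewrite /= addr0 subr0.
have sA x y : s (x + y) = s x + s y.
  apply/eqP; rewrite eq_le sD/=.
  by have := sD (- x) (- y); rewrite -opprD !sN; lra.
move=> a x y; rewrite sA; congr (_ + _).
have [a0|a0] := leP 0 a; first exact: sZ.
by rewrite -[a]opprK scaleNr sN sZ ?oppr_ge0 ?(ltW a0)// scaleNr.
Qed.

(** The Mazur-Orlicz form of the Hahn-Banach theorem: besides [L <= p] one can
    prescribe lower bounds for [L] along a convex cone, as long as [p] does not
    contradict them. *)
Theorem hahn_banach_cone p G : sublinear p -> convex_cone G ->
  (forall f, G f -> f.2 <= p f.1) ->
  exists L : {linear V -> R^o},
    (forall x, L x <= p x) /\ (forall f, G f -> f.2 <= L f.1).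
Proof.
move=> sp cG Gp; have sG := cone_inf_sublinear sp cG Gp.
have [s [ss sle smin]] := minimal_sublinear sG.
have ls := minimal_sublinear_linear ss smin.
pose Lm := GRing.isLinear.Build R V R^o _ (s : V -> R^o) ls.
pose L : {linear V -> R^o} := HB.pack (s : V -> R^o) Lm.
exists L; split=> [x|f Gf].
  have [G0 _ _] := cG; apply: (le_trans (sle x)).
  by have := cone_inf_le sp cG Gp x G0; rewrite /= addr0 subr0.
have := cone_inf_le sp cG Gp (- f.1) Gf; rewrite addNr sublinear0//.
have := sle (- f.1); have -> : s (- f.1) = - L f.1 by exact: (linearN L).
by lra.
Qed.

End HahnBanach.

(** A norming functional: prescribe [t |x|] at [t x] for [t >= 0]. *)
Lemma norming_functional (R : realType) (V : normedModType R) (x : V) :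
  exists f : dual V, `|f| <= 1 /\ operator_fun f x = `|x|.
Proof.
have sn : sublinear (fun v : V => `|v|).
  split=> [u v|a u a0]; first exact: ler_normD.
  by rewrite normrZ ger0_norm.
pose G : set (V * R) := [set (a *: x, a * `|x|) | a in [set a | 0 <= a]].
have [||L [Ln LG]] := @hahn_banach_cone R V _ G sn.
- split=> [|_ _ [a a0 <-] [b b0 <-]|b _ b0 [a a0 <-]].
  + by exists 0; rewrite /= ?lexx ?scale0r ?mul0r.
  + by exists (a + b); rewrite /= ?addr_ge0// scalerDl mulrDl.
  + by exists (b * a); rewrite /= ?mulr_ge0 ?(ltW b0)// scalerA mulrA.
- by move=> _ [a a0 <-] /=; rewrite normrZ ger0_norm.
have Lle v : `|L v| <= `|v|.
  by rewrite ler_norml Ln andbT lerNl -linearN (le_trans (Ln _))// normrN.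
have Lop : (L : V -> R^o) \in @is_operator R V R^o.
  apply: (@bounded_is_operator _ _ _ _ 1) => [|v]; first exact: linearP.
  by rewrite mul1r; exact: Lle.
exists (Operator Lop); split.
  by apply: operator_norm_lub => v v1; exact: le_trans (Lle v) _.
apply/eqP; rewrite eq_le; apply/andP; split; first exact: Ln.
have := LG (x, `|x|); apply; exists 1; rewrite /= ?ler01//.
by rewrite scale1r mul1r.
Qed.

(** * Radon probabilities dominating finitely additive ones *)

Definition finitely_additive_probability (R : realType) (T : Type)
    (m : set T -> R) : Prop :=
  [/\ forall A, 0 <= m A, m setT = 1 &
     forall A B, A `&` B = set0 -> m (A `|` B) = m A + m B].

Section FinitelyAdditive.
Variables (R : realType) (T : Type) (m : set T -> R).
Hypothesis m_fap : finitely_additive_probability m.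

Lemma fap0 : m set0 = 0.
Proof.
have [_ _ /(_ set0 set0 (setI0 _))] := m_fap.
by rewrite setU0 => /eqP; rewrite -subr_eq0 opprD addNKr oppr_eq0 => /eqP.
Qed.

Lemma fap_le A B : A `<=` B -> m A <= m B.
Proof.
move=> AB; have [m0 _ mD] := m_fap.
by rewrite -(setDUK AB) mD ?lerDl ?m0// setDIK.
Qed.

Lemma fapU_le A B : m (A `|` B) <= m A + m B.
Proof.
have [_ _ mD] := m_fap; rewrite -{1}(setDUK (@subsetUl _ A B)).
by rewrite mD ?setDIK// lerD2l fap_le// => x [[]].
Qed.

Lemma fap_le1 A : m A <= 1.
Proof. by have [_ <- _] := m_fap; exact: fap_le. Qed.

End FinitelyAdditive.

Section RadonMajorant.
Variables (R : realType) (T : ptopologicalType).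
Hypotheses (hT : hausdorff_space T) (cT : compact [set: T]).
Variable m : set T -> R.
Hypothesis m_fap : finitely_additive_probability m.

Lemma closed_shrink (C G : set T) : closed C -> open G -> C `<=` G ->
  exists V, [/\ open V, C `<=` V & closure V `<=` G].
Proof.
move=> cC oG CG; have nC : set_nbhs C G.
  by apply/set_nbhsP; exists G; split.
have [V /set_nbhsP[W [oW CW WV]] VG] := compact_normal hT cT cC nC.
by exists W; split=> //; apply: subset_trans VG; exact: closure_subset.
Qed.

(** The value at an open set only sees the mass that [m] gives to its closed subsets;
    this is what makes compactness yield countable subadditivity. *)
Definition inner_content (G : set T) : R :=
  sup [set m C | C in [set C | closed C /\ C `<=` G]].

Local Notation nu := inner_content.

Lemma inner_content_has_sup G :
  has_sup [set m C | C in [set C | closed C /\ C `<=` G]].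
Proof.
split; first by exists (m set0), set0 => //; split => //; exact: closed0.
by exists 1 => _ [C _ <-]; exact: fap_le1.
Qed.

Lemma le_inner_content C G : closed C -> C `<=` G -> m C <= nu G.
Proof.
by move=> cC CG; apply: ub_le_sup; [case: (inner_content_has_sup G)|exists C].
Qed.

Lemma inner_content_le G c :
  (forall C, closed C -> C `<=` G -> m C <= c) -> nu G <= c.
Proof.
move=> H; apply: ge_sup; first by case: (inner_content_has_sup G).
by move=> _ [C [cC CG] <-]; exact: H.
Qed.

Lemma inner_content_ge0 G : 0 <= nu G.
Proof.
by rewrite -(fap0 m_fap); apply: le_inner_content => //; exact: closed0.
Qed.

Lemma inner_content_mono G G' : G `<=` G' -> nu G <= nu G'.
Proof.
move=> GG'; apply: inner_content_le => C cC CG; apply: le_inner_content => //.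
exact: subset_trans GG'.
Qed.

(** Normality splits a closed subset of a union of two open sets
    into closed subsets of the two. *)
Lemma closed_sub_bigcup_content (G : (set T)^nat) n C :
  (forall i, open (G i)) -> closed C -> C `<=` \bigcup_(i < n) G i ->
  m C <= \sum_(i < n) nu (G i).
Proof.
move=> oG; elim: n C => [|n IH] C cC CG.
  rewrite big_ord0 (_ : C = set0) ?(fap0 m_fap)// -subset0.
  by move=> x /CG[].
pose B := \bigcup_(i < n) G i.
have oB : open B by apply: bigcup_open => i _.
have [||V [oV CV VG]] := closed_shrink _ (oG n) (C := C `&` ~` B).
- by apply: closedI => //; exact: open_closedC.
- move=> x [/CG[i /= + Gix] nB]; rewrite ltnS leq_eqVlt => /predU1P[<-//|lin].
  by case: nB; exists i.
rewrite big_ord_recr/=.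
have /le_trans : m C <= m (C `&` ~` V) + m (C `&` closure V).
  apply: le_trans (fap_le m_fap _) (fapU_le m_fap _ _) => x Cx.
  by have [Vx|nVx] := pselect (V x); [right; split=> //; exact: subset_closure|left].
apply; apply: lerD.
  apply: IH; first by apply: closedI => //; exact: open_closedC.
  by move=> x [Cx nVx]; apply: contrapT => nB; apply: nVx; apply: CV.
apply: le_inner_content; last by move=> x [_ /VG].
by apply: closedI => //; exact: closed_closure.
Qed.

Lemma compact_sub_bigcup (G : (set T)^nat) C : (forall i, open (G i)) ->
  closed C -> C `<=` \bigcup_i G i -> exists n, C `<=` \bigcup_(i < n) G i.
Proof.
move=> oG cC CG; have kC : compact C by exact: subclosed_compact cT _.
have /compact_near_coveringP := kC.
move=> /(_ nat \oo (fun n x => (\bigcup_(i < n) G i) x) _)[|n _ H].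
- move=> x /CG[i _ Gix]; exists (G i, [set n | (i < n)%N]) => /=.
    split; first by apply: open_nbhs_nbhs; split.
    by exists i.+1.
  by move=> [y n] /= [Giy lin]; exists i.
- by exists n; exact: (H n) (leqnn n).
Qed.

Local Open Scope ereal_scope.

Lemma inner_content_sigma_subadditive (G : (set T)^nat) :
  (forall i, open (G i)) ->
  (nu (\bigcup_i G i))%:E <= \sum_(i <oo) (nu (G i))%:E.
Proof.
move=> oG; set s := \sum_(i <oo) _.
have s0 : 0 <= s by apply: nneseries_ge0 => i _ _; rewrite lee_fin inner_content_ge0.
case sE : s s0 => [s'| |] s0; [|by rewrite leey|by []].
rewrite lee_fin; apply: inner_content_le => C cC CG.
have [n Cn] := compact_sub_bigcup oG cC CG.
apply: (le_trans (closed_sub_bigcup_content oG cC Cn)).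
rewrite -lee_fin -sE /s -sumEFin -(big_mkord xpredT (fun i => (nu (G i))%:E)).
by apply: nneseries_lim_ge => i _; rewrite lee_fin inner_content_ge0.
Qed.

Definition outer_content (A : set T) : \bar R :=
  ereal_inf [set (nu G)%:E | G in [set G | open G /\ A `<=` G]].

Local Notation mu := outer_content.

Lemma outer_content_le A G : open G -> A `<=` G -> mu A <= (nu G)%:E.
Proof. by move=> oG AG; apply: ereal_inf_lbound; exists G. Qed.

Lemma le_outer_content A c :
  (forall G, open G -> A `<=` G -> c <= (nu G)%:E) -> c <= mu A.
Proof. by move=> H; apply: le_ereal_inf_tmp => _ [G [oG AG] <-]; exact: H. Qed.

Lemma outer_content_ge0 A : 0 <= mu A.
Proof. by apply: le_outer_content => G _ _; rewrite lee_fin inner_content_ge0. Qed.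

Lemma outer_content_open G : open G -> mu G = (nu G)%:E.
Proof.
move=> oG; apply/eqP; rewrite eq_le outer_content_le//=.
by apply: le_outer_content => G' _ GG'; rewrite lee_fin inner_content_mono.
Qed.

Lemma outer_content_setT : mu setT = 1.
Proof.
rewrite outer_content_open; last exact: openT.
congr EFin; apply/eqP; rewrite eq_le; apply/andP; split.
  by apply: inner_content_le => C _ _; exact: fap_le1.
by case: (m_fap) => _ <- _; apply: le_inner_content => //; exact: closedT.
Qed.

Lemma outer_content_mono : {homo mu : A B / A `<=` B >-> A <= B}.
Proof.
move=> A B AB; apply: le_outer_content => G oG BG.
by apply: outer_content_le => //; exact: subset_trans BG.
Qed.

Lemma outer_content_fin_num A : mu A \is a fin_num.
Proof.
rewrite ge0_fin_numE ?outer_content_ge0//.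
by apply: (@le_lt_trans _ _ 1); [rewrite -outer_content_setT outer_content_mono|rewrite ltry].
Qed.

Lemma outer_content0 : mu set0 = 0.
Proof.
rewrite outer_content_open; last exact: open0.
congr EFin; apply/eqP; rewrite eq_le inner_content_ge0 andbT.
by apply: inner_content_le => C _; rewrite subset0 => ->; rewrite (fap0 m_fap).
Qed.

Lemma outer_content_adherent A (e : R) : (0 < e)%R ->
  exists G, [/\ open G, A `<=` G & (nu G)%:E <= mu A + e%:E].
Proof.
move=> e0; have [_ [G [oG AG] <-] Ge] := lb_ereal_inf_adherent e0 (outer_content_fin_num A).
by exists G; split=> //; exact: ltW.
Qed.

Lemma outer_content_sigma_subadditive : sigma_subadditive mu.
Proof.
move=> A; apply/lee_addgt0Pr => e e0.
have e2 n : (0 < e / (2 ^ n.+1)%:R)%R by rewrite divr_gt0// ltr0n expn_gt0.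
have /choice[G GP] n := outer_content_adherent (A n) (e2 n).
apply: le_trans (epsilon_trick _ (fun n => outer_content_ge0 (A n)) (ltW e0)).
apply: (@le_trans _ _ (\sum_(i <oo) (nu (G i))%:E)).
  apply: le_trans (inner_content_sigma_subadditive _); last first.
    by move=> i; case: (GP i).
  apply: outer_content_le; first by apply: bigcup_open => i _; case: (GP i).
  by move=> x [i _ Aix]; exists i => //; case: (GP i) => _ + _; apply.
apply: lee_nneseries => i _; first by rewrite lee_fin inner_content_ge0.
by case: (GP i).
Qed.

HB.instance Definition _ := isOuterMeasure.Build R T mu outer_content0
  outer_content_ge0 outer_content_mono outer_content_sigma_subadditive.

(** Given an open [V], nearly exhaust its intersection with [G] by a closed [C],
    and then the open remainder [V \ C] by a closed [D]; these are disjoint closed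
    subsets of [V]. *)
Lemma open_caratheodory G : open G -> mu.-caratheodory G.
Proof.
move=> oG; apply: le_caratheodory_measurable => X.
apply: le_outer_content => V oV XV.
apply/lee_addgt0Pr => e e0; have e20 : (0 < e / 2)%R by rewrite divr_gt0.
have [_ [C [cC CVG] <-] Ce] := sup_adherent e20 (inner_content_has_sup (V `&` G)).
have [_ [D [cD DVC] <-] De] := sup_adherent e20 (inner_content_has_sup (V `&` ~` C)).
have CD : (m C + m D <= nu V)%R.
  case: (m_fap) => _ _ <-; last first.
    by rewrite -subset0 => x [Cx /DVC[]].
  apply: le_inner_content; first exact: closedU.
  by move=> x [/CVG[]|/DVC[]].
apply: (@le_trans _ _ ((nu (V `&` G))%:E + (nu (V `&` ~` C))%:E)).
  apply: leeD; apply: outer_content_le.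
  - exact: openI.
  - exact: setSI.
  - by apply: openI => //; exact: closed_openC.
  - by apply: setISS => // x nGx /CVG[_].
rewrite -/(nu (V `&` G)) in Ce; rewrite -/(nu (V `&` ~` C)) in De.
rewrite -!EFinD lee_fin; lra.
Qed.

Let bT := g_sigma_algebraType (@open T).

Lemma borel_caratheodory (A : set bT) : measurable A -> mu.-caratheodory A.
Proof.
move: A; apply: smallest_sub; last exact: open_caratheodory.
split=> [|A cA|A cA].
- exact: caratheodory_measurable_set0.
- by rewrite setTD; exact: caratheodory_measurable_setC.
- exact: caratheodory_measurable_bigcup.
Qed.

Definition radon_measure : set bT -> \bar R := mu.

Let radon0 : radon_measure set0 = 0. Proof. exact: outer_content0. Qed.

Let radon_ge0 A : 0 <= radon_measure A. Proof. exact: outer_content_ge0. Qed.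

Let radon_sigma_additive : semi_sigma_additive radon_measure.
Proof.
move=> A mA tA mUA; apply: (@caratheodory_measure_sigma_additive _ _ mu) => //.
  by move=> i; exact: borel_caratheodory.
exact: borel_caratheodory.
Qed.

HB.instance Definition _ := isMeasure.Build _ _ _ radon_measure
  radon0 radon_ge0 radon_sigma_additive.

HB.instance Definition _ := Measure_isProbability.Build _ _ _ radon_measure
  outer_content_setT.

(** Passing to complements turns outer regularity into inner regularity,
    because closed sets are compact. *)
Lemma radon_measure_regular (A : set bT) : measurable A ->
  radon_measure A = ereal_inf [set radon_measure G | G in
    [set G : set T | open G /\ A `<=` G]] /\
  radon_measure A = ereal_sup [set radon_measure C | C in
    [set C : set T | compact C /\ C `<=` A]].
Proof.
move=> mA; split.
  rewrite /radon_measure {1}/outer_content; congr ereal_inf.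
  by apply/seteqP; split=> [_ [G [oG AG] <-]|_ [G [oG AG] <-]];
    exists G => //; rewrite outer_content_open.
apply/eqP; rewrite eq_le; apply/andP; split; last first.
  apply: ge_ereal_sup => _ [C [cC CA] <-]; exact: outer_content_mono.
apply/lee_addgt0Pr => e e0.
have [G [oG AG Ge]] := outer_content_adherent (~` A) e0.
have mG : measurable (G : set bT) by exact: sub_sigma_algebra.
have muC (B : set bT) : measurable B -> radon_measure B = 1 - radon_measure (~` B).
  by move=> mB; rewrite -{1}[B]setCK probability_setC//; exact: measurableC.
apply: (@le_trans _ _ (radon_measure (~` G) + e%:E)); last first.
  rewrite leeD2r//; apply: ereal_sup_ubound; exists (~` G) => //; split.
    by apply: (subclosed_compact _ cT) => //; exact: open_closedC.
  by move=> x nGx; apply: contrapT => /AG.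
rewrite (muC _ mA) (muC (~` G)) ?setCK; last exact: measurableC.
have Gfin : radon_measure G \is a fin_num by exact: outer_content_fin_num.
have Afin : radon_measure (~` A) \is a fin_num by exact: outer_content_fin_num.
have : radon_measure G <= radon_measure (~` A) + e%:E.
  by rewrite [leLHS]outer_content_open.
have real_ineq (a b : R) :
    a%:E <= b%:E + e%:E -> 1%:E - b%:E <= 1%:E - a%:E + e%:E.
  by rewrite -!EFinB -!EFinD !lee_fin; lra.
by rewrite -(fineK Gfin) -(fineK Afin); exact: real_ineq.
Qed.

Lemma radon_measure_closed (C : set bT) : closed (C : set T) ->
  (m C)%:E <= radon_measure C.
Proof.
move=> cC; apply: le_outer_content => G oG CG; rewrite lee_fin.
exact: le_inner_content.
Qed.

(** A one-sided form of the Riesz representation theorem. The inequality is strict in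
    general: a purely finitely additive [m] can escape every compact subset of an
    open set, and that mass is moved to the boundary. *)
Theorem radon_majorant : exists mu : probability bT R,
  (forall A : set bT, measurable A ->
     mu A = ereal_inf [set mu G | G in [set G : set T | open G /\ A `<=` G]] /\
     mu A = ereal_sup [set mu C | C in
       [set C : set T | compact C /\ C `<=` A]]) /\
  (forall C : set T, closed C -> (m C)%:E <= mu C).
Proof.
exists radon_measure; split; first exact: radon_measure_regular.
exact: radon_measure_closed.
Qed.

End RadonMajorant.

(** * Means on bounded functions *)

Section BoundedFunctions.
Variables (R : realType) (K : Type).

Definition fbounded (f : K -> R) : Prop := exists M, forall x, `|f x| <= M.

Definition is_fbounded : {pred K -> R} := mem [set f | fbounded f].

Lemma fbounded_submod_closed : submod_closed is_fbounded.
Proof.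
split=> [|a f g /set_mem[M fM] /set_mem[N gN]]; apply/mem_set.
  by exists 0 => x; rewrite normr0.
exists (`|a| * M + N) => x; apply: (le_trans (ler_normD _ _)).
by apply: lerD => //; rewrite [leLHS]normrM ler_wpM2l.
Qed.

Record bfun := Bfun { bfun_fun :> K -> R; bfunP : bfun_fun \in is_fbounded }.

HB.instance Definition _ := [isSub for bfun_fun].
HB.instance Definition _ := [Choice of bfun by <:].
HB.instance Definition _ :=
  GRing.isSubmodClosed.Build R (K -> R) is_fbounded fbounded_submod_closed.
HB.instance Definition _ := [SubChoice_isSubLmodule of bfun by <:].

Lemma fboundedD a (f g : K -> R) : fbounded f -> fbounded g ->
  fbounded (fun x => a * f x + g x).
Proof.
move=> bf bg; apply/set_mem.
by have [_ /(_ a f g)] := fbounded_submod_closed; apply; exact/mem_set.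
Qed.

Lemma fbounded_cst (c : R) : fbounded (fun=> c).
Proof. by exists `|c|. Qed.

Lemma fbounded_itv c (f : K -> R) : (forall x, 0 <= f x <= c) -> fbounded f.
Proof. by move=> f0c; exists c => x; have /andP[f0 ?] := f0c x; rewrite ger0_norm. Qed.

(** The functional is total, but only its values at bounded functions are
    constrained. *)
Definition mean (L : (K -> R) -> R) : Prop :=
  [/\ L (fun=> 1) = 1,
      forall a f g, fbounded f -> fbounded g ->
        L (fun x => a * f x + g x) = a * L f + L g &
      forall f, fbounded f -> (forall x, 0 <= f x) -> 0 <= L f].

Section Mean.
Variables (L : (K -> R) -> R).
Hypothesis mL : mean L.

Lemma mean0 : L (fun=> 0) = 0.
Proof.
have [_ LD _] := mL.
have := LD 1 _ _ (fbounded_cst 0) (fbounded_cst 0).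
by under eq_fun do rewrite mulr0 addr0; rewrite mul1r; lra.
Qed.

Lemma meanZ a f : fbounded f -> L (fun x => a * f x) = a * L f.
Proof.
move=> bf; have [_ LD _] := mL; have := LD a _ _ bf (fbounded_cst 0).
by rewrite mean0 addr0 => <-; under [in RHS]eq_fun do rewrite addr0.
Qed.

Lemma meanD f g : fbounded f -> fbounded g ->
  L (fun x => f x + g x) = L f + L g.
Proof.
move=> bf bg; have [_ LD _] := mL; have := LD 1 _ _ bf bg.
by rewrite mul1r => <-; under [in RHS]eq_fun do rewrite mul1r.
Qed.

Lemma mean_cst c : L (fun=> c) = c.
Proof.
have [L1 _ _] := mL; have := meanZ c (fbounded_cst 1).
by under eq_fun do rewrite mulr1; rewrite L1 mulr1.
Qed.

Lemma le_mean f g : fbounded f -> fbounded g -> (forall x, f x <= g x) ->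
  L f <= L g.
Proof.
move=> bf bg fg; have [_ LD L0] := mL.
have /L0 : fbounded (fun x => -1 * f x + g x) by exact: fboundedD.
rewrite LD// mulN1r addrC subr_ge0; apply => x.
by rewrite mulN1r addrC subr_ge0.
Qed.

Lemma fbounded_indic (A : set K) : fbounded (\1_A : K -> R).
Proof.
by apply: (@fbounded_itv 1) => x; rewrite indicE; case: (x \in A); rewrite ?lexx ler01.
Qed.

Lemma fbounded_sum n (f : nat -> K -> R) : (forall i, fbounded (f i)) ->
  fbounded (fun x => \sum_(i < n) f i x).
Proof.
move=> bf; elim: n => [|n IH].
  by under eq_fun do rewrite big_ord0; exact: fbounded_cst.
under eq_fun do rewrite big_ord_recr/= -[X in X + _]mul1r.
exact: fboundedD.
Qed.

Lemma mean_sum n (f : nat -> K -> R) : (forall i, fbounded (f i)) ->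
  L (fun x => \sum_(i < n) f i x) = \sum_(i < n) L (f i).
Proof.
move=> bf; elim: n => [|n IH].
  by under eq_fun do rewrite big_ord0; rewrite mean0 big_ord0.
under eq_fun do rewrite big_ord_recr/=.
by rewrite meanD// ?IH ?big_ord_recr//; exact: fbounded_sum.
Qed.

Lemma mean_fap : finitely_additive_probability (fun A => L (\1_A)).
Proof.
have [L1 LD L0] := mL; split=> [A||A B AB].
- by apply: L0 => [|x]; [exact: fbounded_indic|rewrite indicE].
- by rewrite -[RHS]L1; congr L; apply/funext => x; rewrite indicE in_setT.
- rewrite -meanD; [|exact: fbounded_indic..].
  congr L; apply/funext => x; rewrite !indicE in_setU.
  have [/set_mem xA|_] := boolP (x \in A); have [/set_mem xB|_] := boolP (x \in B);
    rewrite ?addr0 ?add0r//.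
  by have : (A `&` B) x by []; rewrite AB.
Qed.

End Mean.

(** Hahn-Banach for the supremum functional: the lower bound [0] on [C] is compatible
    with it, and a linear functional below the supremum is positive and
    normalized. *)
Theorem mean_ge0_cone (C : set (K -> R)) (k0 : K) :
  (forall f, C f -> fbounded f) -> C (fun=> 0) ->
  (forall f g, C f -> C g -> C (fun x => f x + g x)) ->
  (forall a f, 0 < a -> C f -> C (fun x => a * f x)) ->
  (forall f c, C f -> (forall x, f x <= c) -> 0 <= c) ->
  exists L, mean L /\ forall f, C f -> 0 <= L f.
Proof.
move=> Cb C0 CD CZ Csup.
pose p (f : bfun) := sup (range f).
have hs (f : bfun) : has_sup (range f).
  split; first by exists (f k0), k0.
  have [M fM] := set_mem (bfunP f).
  by exists M => _ [x _ <-]; exact: le_trans (ler_norm _) (fM x).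
have pub (f : bfun) x : f x <= p f.
  by apply: ub_le_sup; [case: (hs f)|exists x].
have plub (f : bfun) c : (forall x, f x <= c) -> p f <= c.
  by move=> fc; apply: ge_sup; [case: (hs f)|move=> _ [x _ <-]].
have pZ a f : 0 < a -> p (a *: f) <= a * p f.
  by move=> a0; apply: plub => x; rewrite [leLHS]/= ler_pM2l.
have sp : sublinear p.
  split=> [f g|a f]; first by apply: plub => x; exact: lerD.
  rewrite le_eqVlt => /predU1P[<-|a0].
    rewrite scale0r mul0r; apply/eqP; rewrite eq_le plub//=.
    exact: (pub 0 k0).
  apply/eqP; rewrite eq_le pZ//= -ler_pdivlMl//.
  rewrite (le_trans _ (pZ _ _ _)) ?invr_gt0//.
  by rewrite scalerA mulVf ?gt_eqF// scale1r.
pose G : set (bfun * R) := [set f : bfun * R | C f.1 /\ f.2 = 0].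
have [||L [Lp LG]] := @hahn_banach_cone R _ p G sp.
- split=> [|[f a] [g b] [/= Cf ->] [/= Cg ->]|a [f b] a0 [/= Cf ->]].
  + by split.
  + by split; [exact: CD|rewrite /= addr0].
  + by split; [exact: CZ|exact: mulr0].
- by move=> [f a] [/= Cf ->]; apply: (Csup _ _ Cf) => x; exact: pub.
have LN (f : bfun) c : (forall x, f x <= c) -> L f <= c.
  by move=> fc; apply: (le_trans (Lp _)); exact: plub.
pose ext (f : K -> R) : bfun :=
  if pselect (fbounded f) is left bf then Bfun (mem_set bf) else 0.
have extE f : fbounded f -> ext f = f :> (K -> R).
  by rewrite /ext; case: pselect.
exists (L \o ext); split; last first.
  move=> f Cf; have := LG (ext f, 0); apply; split => //=.
  by rewrite extE//; exact: Cb.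
have L0 f : fbounded f -> (forall x, 0 <= f x) -> 0 <= L (ext f).
  move=> bf f0; rewrite -oppr_le0 -linearN; apply: LN => x.
  by rewrite [leLHS]/= extE// oppr_le0.
split=> //= [|a f g bf bg].
  apply/eqP; rewrite eq_le; apply/andP; split.
    by apply: LN => x; rewrite extE//; exact: fbounded_cst.
  rewrite -lerN2 -linearN; apply: LN => x.
  by rewrite [leLHS]/= extE//; exact: fbounded_cst.
rewrite -[a * _]/(a *: _) -linearP; congr (L _); apply/val_inj/funext => x /=.
rewrite extE; last exact: fboundedD.
by rewrite -[RHS]/(a * ext f x + ext g x) !extE.
Qed.

End BoundedFunctions.

Lemma mean_comp (R : realType) (K K' : Type) (h : K -> K')
    (L : (K -> R) -> R) : mean L -> mean (fun f => L (f \o h)).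
Proof.
have bh (f : K' -> R) : fbounded f -> fbounded (f \o h).
  by move=> [M fM]; exists M => x; exact: fM.
move=> [L1 LD L0]; split=> // [a f g bf bg|f bf f0].
  by rewrite -LD//; exact: bh.
by apply: L0 => [|x]; [exact: bh|exact: f0].
Qed.

Lemma open_measurable_fun (R : realType) (T : ptopologicalType) (f : T -> R) :
  continuous f -> measurable_fun [set: g_sigma_algebraType (@open T)] f.
Proof.
move=> /continuousP cf.
apply: (measurability _ (RGenOpens.measurableE R)) => _ [_ [a [b ->] <-]].
by rewrite setTI; apply: sub_sigma_algebra; apply: cf; exact: interval_open.
Qed.

(** The lower Lebesgue sum of [f] with the levels [e], [2 e], ..., [n e]. *)
Definition staircase (R : realType) (T : Type) (e : R) (f : T -> R) n x : R :=
  \sum_(i < n) e * \1_[set y | i.+1%:R * e <= f y] x.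

Lemma staircase_approx (R : realType) (T : Type) (e : R) (f : T -> R) n x :
  0 < e -> 0 <= f x <= n%:R * e ->
  staircase e f n x <= f x <= staircase e f n x + e.
Proof.
move=> e0 /andP[f0 fn].
(* The staircase falls short by more than [e] only if all its steps are used. *)
have : [/\ staircase e f n x <= n%:R * e, staircase e f n x <= f x &
    f x <= staircase e f n x + e \/ staircase e f n x = n%:R * e].
  elim: {fn}n => [|n [sn sf IH]].
    by rewrite /staircase big_ord0 mul0r; split=> //; right.
  have nS : n.+1%:R * e = n%:R * e + e by rewrite -natr1 mulrDl mul1r.
  rewrite /staircase big_ord_recr/= -/(staircase e f n x) indicE.
  have [/set_mem /= nf|] := boolP (x \in _).
    rewrite mulr1 nS in nf *; split; [lra|lra|].
    by case: IH => [?|->]; [left; lra|right].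
  rewrite notin_setE/= => /negP; rewrite -ltNge nS => nf; rewrite mulr0 addr0.
  by split => //; [lra|left; case: IH => // snE; lra].
move=> [_ sf [fs|sE]]; first by rewrite sf fs.
by rewrite sf/= sE; lra.
Qed.

(** The levels [f >= c] of a continuous function are closed, so the mean of a staircase
    below [f] is at most its integral. *)
Theorem mean_le_integral (R : realType) (T : ptopologicalType)
    (L : (T -> R) -> R) (mu : probability (g_sigma_algebraType (@open T)) R)
    (f : T -> R) :
  mean L -> (forall C : set T, closed C -> ((L \1_C)%:E <= mu C)%E) ->
  continuous f -> fbounded f -> (forall x, 0 <= f x) ->
  ((L f)%:E <= \int[mu]_x (f x)%:E)%E.
Proof.
move=> mL Lmu cf bf f0; apply/lee_addgt0Pr => e e0.
have [M fM] := bf.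
(* [n] steps of height [e] reach above the bound [M] of [f]. *)
pose n := (Num.truncn (M / e)).+1; pose A (i : nat) := [set y | i.+1%:R * e <= f y].
have cA i : closed (A i).
  by have := closed_comp (fun x _ => cf x) (@closed_ge R (i.+1%:R * e)).
have mA i : measurable (A i : set (g_sigma_algebraType (@open T))).
  rewrite -[A i]setCK; apply: measurableC; apply: sub_sigma_algebra.
  exact: closed_openC.
have fn x : 0 <= f x <= n%:R * e.
  rewrite f0/= -ler_pdivrMr//; apply: ltW.
  rewrite (le_lt_trans _ (truncnS_gt _))// ler_pM2r ?invr_gt0//.
  exact: le_trans (ler_norm _) (fM x).
have bA i : fbounded (fun x => e * \1_(A i) x).
  have := fboundedD e (fbounded_indic R (A i)) (fbounded_cst T (0 : R)).
  by under eq_fun do rewrite addr0.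
have step_ge0 i x : 0 <= e * \1_(A i) x.
  by rewrite mulr_ge0 ?(ltW e0)// indicE.
have mstep i : measurable_fun [set: g_sigma_algebraType (@open T)]
    (fun x => e * \1_(A i) x).
  by apply: measurable_funM => //; exact: measurable_indic.
have bs : fbounded (staircase e f n) by exact: (fbounded_sum n bA).
apply: (@le_trans _ _ (L (staircase e f n) + e)%:E).
  rewrite lee_fin -[X in _ + X](mean_cst mL) -meanD//; last exact: fbounded_cst.
  apply: le_mean => // [|x].
    have := fboundedD 1 bs (fbounded_cst T e).
    by under eq_fun do rewrite mul1r.
  by have /andP[_] := staircase_approx e0 (fn x).
rewrite EFinD leeD2r//.
apply: (@le_trans _ _ (\int[mu]_x (staircase e f n x)%:E)%E); last first.
  apply: ge0_le_integral => //=.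
  - by move=> x _; rewrite lee_fin sumr_ge0// => i _; exact: step_ge0.
  - apply/measurable_EFinP; rewrite /staircase.
    by apply: measurable_sum => i; exact: mstep.
  - by apply/measurable_EFinP; exact: open_measurable_fun.
  - by move=> x _; rewrite lee_fin; have /andP[] := staircase_approx e0 (fn x).
rewrite [X in (X%:E)%E](mean_sum mL n bA) -sumEFin.
under [leRHS]eq_integral do rewrite /staircase -sumEFin.
rewrite ge0_integral_sum//=; last 2 first.
- by move=> i; apply/measurable_EFinP; exact: mstep.
- by move=> i x _; rewrite lee_fin; exact: step_ge0.
apply: lee_sum => i _.
rewrite (meanZ mL); last exact: fbounded_indic.
under eq_integral do rewrite EFinM.
rewrite ge0_integralZl//=; last 2 first.
- by apply/measurable_EFinP; apply: measurable_indic; exact: mA.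
- exact: ltW.
rewrite integral_indic//; last exact: mA.
rewrite setIT EFinM lee_pmul2l ?lte_fin//.
exact: Lmu.
Qed.

(** * The weak* topology of the dual ball *)

Lemma initial_cvgP (S : choiceType) (T : topologicalType) (f : S -> T)
    (F : set_system S) (s : S) : Filter F ->
  F --> (s : initial_topology f) <-> f @ F --> f s.
Proof.
move=> FF; split=> [Fs|Ffs].
  by apply: cvg_trans (@initial_continuous _ _ f s); exact: cvg_app.
move=> U [_ [[B oB <-] Bs BU]]; apply: filterS BU _; apply: Ffs.
exact: open_nbhs_nbhs.
Qed.

Lemma sot_cvgP (R : realType) (V W : normedModType R)
    (F : set_system (operator V W)) (f : operator V W) : Filter F ->
  F --> (f : sot V W) <->
  forall v, (fun g : operator V W => g v) @ F --> f v.
Proof.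
move=> FF; split=> [/initial_cvgP|Ff].
  by move=> /(@pointwise_cvgP _ _ _ _ _)/[swap] v; apply.
apply/initial_cvgP/(@pointwise_cvgP _ _ _ _ _) => v; exact: Ff.
Qed.

Section DualBall.
Variables (R : realType) (X : normedModType R).

Definition ball_eval (v : X) (x : dual_ball X) : R :=
  operator_fun (ball_incl x) v.

Lemma ball_incl_le1 (x : dual_ball X) : `|ball_incl x| <= 1.
Proof. exact: (set_mem (valP x)). Qed.

Lemma dual_ball_cvgP (F : set_system (dual_ball X)) (x : dual_ball X) :
  Filter F ->
  F --> x <-> forall v, ball_eval v @ F --> ball_eval v x.
Proof.
move=> FF; split=> [/initial_cvgP/sot_cvgP Fx v|Fx]; first exact: Fx.
by apply/initial_cvgP/sot_cvgP => v; exact: Fx.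
Qed.

Lemma ball_eval_continuous v : continuous (ball_eval v).
Proof.
by move=> x; exact: (proj1 (dual_ball_cvgP x (nbhs_filter x)) (fun A => id) v).
Qed.

Lemma dual_ball_hausdorff : hausdorff_space (dual_ball X).
Proof.
move=> x y xy; apply/val_inj/val_inj/funext => v.
apply: (@norm_hausdorff R R^o) => A B xA yB.
have [z [Az Bz]] := xy _ _ (@ball_eval_continuous v x A xA) (@ball_eval_continuous v y B yB).
by exists (ball_eval v z).
Qed.

(** Banach-Alaoglu: along an ultrafilter the evaluations converge, because
    they take values in compact intervals, and the pointwise limit of
    functionals is a functional. *)
Lemma dual_ball_compact : compact [set: dual_ball X].
Proof.
rewrite compact_ultra => F FU _.
have evF v : exists l : R, ball_eval v @ F --> l /\ `|l| <= `|v|.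
  have [|l []] := @segment_compact R (- `|v|) `|v| (ball_eval v @ F).
  - by apply: nearW => x /=; rewrite in_itv/= -ler_norml;
      rewrite (le_trans (operator_norm_le _ _))// ler_piMl// ball_incl_le1.
  - rewrite /= in_itv/= -ler_norml => lv clF; exists l; split=> // U Ul.
    have [//|FU'] := in_ultra_setVsetC (ball_eval v @^-1` U) FU.
    by have [y []] := clF (~` U) U FU' Ul.
have /choice[l lP] := evF.
have lF v := (lP v).1.
have llin : linear (l : X -> R^o).
  move=> a u v; have := lF (a *: u + v).
  have -> : ball_eval (a *: u + v) = fun x => a * ball_eval u x + ball_eval v x.
    by apply/funext => x; exact: (operator_linear (ball_incl x)).
  move=> H; apply: (cvg_unique (@norm_hausdorff R R^o) H).
  by apply: cvgD => //; apply: cvgMr.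
have lop : (l : X -> R^o) \in @is_operator R X R^o.
  apply: (@bounded_is_operator _ _ _ _ 1) => // v; rewrite mul1r.
  exact: (lP v).2.
have lb : (Operator lop : dual X) \in @unit_ball R (dual X).
  apply/mem_set; apply: operator_norm_lub => v v1.
  exact: le_trans (lP v).2 v1.
exists (exist _ (Operator lop : wstar X) lb : dual_ball X); split=> //.
by apply/dual_ball_cvgP => v; exact: lF.
Qed.

End DualBall.

(** * Completeness and uniform boundedness *)

Lemma normed_complete (R : realType) (V : normedModType R) :
  (forall F : set_system V, ProperFilter F ->
     (forall e, 0 < e -> exists x, F [set y | `|x - y| <= e]) ->
     exists l, forall e, 0 < e -> F [set y | `|l - y| <= e]) ->
  forall F : set_system V, ProperFilter F -> cauchy F -> cvg F.
Proof.
move=> H F FF /cauchyP Fc; have [e e0|l Fl] := H F FF.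
  have [x Fx] := Fc e e0; exists x; apply: filterS Fx => y.
  by rewrite -ball_normE => /ltW.
apply/cvg_ex; exists l; apply/cvg_ballP => e e0.
have e20 : 0 < e / 2 by rewrite divr_gt0.
apply: filterS (Fl _ e20) => y /= ly; rewrite -ball_normE/=.
by apply: le_lt_trans ly _; rewrite ltr_pdivrMr// ltr_pMr// ltr1n.
Qed.

Lemma cvg_of_cauchy_image (R : realType) (V : Type) (W : completeNormedModType R)
    (F : set_system V) (h : V -> W) : ProperFilter F ->
  (forall e, 0 < e -> exists x, F [set y | `|h x - h y| <= e]) ->
  exists l : W, h @ F --> l.
Proof.
move=> FF Fc; have ch : cauchy (h @ F).
  apply: (@cauchy_exP R W) => e e0.
  have e20 : 0 < e / 2 by rewrite divr_gt0.
  have e2 : e / 2 < e by rewrite ltr_pdivrMr// ltr_pMr// ltr1n.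
  have [x Fx] := Fc _ e20; exists (h x).
  suff : F (h @^-1` ball (h x) e) by [].
  apply: filterS Fx => y /= hxy.
  by rewrite -ball_normE/=; exact: le_lt_trans hxy e2.
have /cauchy_cvgP hl := ch; exists (lim (h @ F)); exact: hl.
Qed.

Lemma cvg_norm_le (R : realType) (V : Type) (W : normedModType R)
    (F : set_system V) (h : V -> W) (l : W) (c : R) {FF : ProperFilter F} :
  h @ F --> l -> F [set y | `|h y| <= c] -> `|l| <= c.
Proof.
move=> hl Fc; have := closed_cvg (fun y : R => y <= c) (@closed_le R c) Fc.
by apply; exact: cvg_norm.
Qed.

(** A pointwise limit [l] of a Cauchy filter of operators is an operator: it is
    within [e |v|] of an operator at every [v]. *)
Lemma operator_complete (R : realType) (V : normedModType R)
    (W : completeNormedModType R) (F : set_system (operator V W)) :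
  ProperFilter F -> cauchy F -> cvg F.
Proof.
move: F; apply: normed_complete => F FF Fc.
have bnd (f g : operator V W) e v : `|f - g| <= e -> `|f v - g v| <= e * `|v|.
  move=> fge; rewrite -[f v - g v]/((f - g) v).
  by apply: (le_trans (operator_norm_le _ _)); rewrite ler_wpM2r.
have Fv v : exists l : W, (fun f : operator V W => f v) @ F --> l.
  apply: cvg_of_cauchy_image => e e0.
  have v0 : 0 < `|v| + 1 by rewrite ltr_wpDl.
  have e'0 : 0 < e / (`|v| + 1) by rewrite divr_gt0.
  have [f Ff] := Fc _ e'0; exists f; apply: filterS Ff => g /bnd fg.
  apply: (le_trans (fg v)); rewrite -mulrA ler_piMr ?ltW//.
  by rewrite mulrC ltr_pdivrMr// mul1r ltrDl.
have /choice[l lF] := Fv.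
have close e (f : operator V W) v : F [set g | `|f - g| <= e] ->
    `|f v - l v| <= e * `|v|.
  move=> Ff; have fl : (fun g : operator V W => f v - g v) @ F --> f v - l v.
    by apply: cvgB; [exact: cvg_cst|exact: lF].
  by apply: (cvg_norm_le fl); apply: filterS Ff => g /= /bnd.
have llin : linear l.
  move=> a u v; have H := lF (a *: u + v).
  have {}H : (fun f : operator V W => a *: f u + f v) @ F --> l (a *: u + v).
    apply: cvg_trans H; apply: near_eq_cvg; apply: nearW => f /=.
    by rewrite operator_linear.
  apply: (cvg_unique (@norm_hausdorff R W) H).
  by apply: cvgD => //; apply: cvgZr.
have lop : l \in @is_operator R V W.
  have [f Ff] := Fc 1 ltr01.
  apply: (@bounded_is_operator _ _ _ _ (`|f| + 1)) => // v.
  have -> : l v = f v - (f v - l v) by rewrite opprB addrC subrK.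
  apply: (le_trans (ler_normB _ _)); rewrite mulrDl lerD//.
    exact: operator_norm_le.
  exact: close.
exists (Operator lop) => e e0; have e20 : 0 < e / 2 by rewrite divr_gt0.
have [f Ff] := Fc _ e20; apply: filterS (Ff) => g /= fg.
apply: operator_norm_lub => v v1.
rewrite -[X in `|X|]/(l v - g v) -(subrKA (f v)) addrC.
apply: (le_trans (ler_normD _ _)); rewrite [e]splitr lerD//.
  by apply: (le_trans (bnd _ _ _ v fg)); rewrite ler_piMr// ltW.
rewrite distrC; apply: (le_trans (close _ _ v Ff)).
by rewrite ler_piMr// ltW.
Qed.

HB.instance Definition _ (R : realType) (V : normedModType R)
    (W : completeNormedModType R) :=
  Uniform_isComplete.Build (operator V W) (@operator_complete R V W).

(** Pointwise convergent sequences of operators are pointwise bounded, so that the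
    uniform boundedness principle applies. *)
Lemma sot_cvg_bounded (R : realType) (V : completeNormedModType R)
    (W : normedModType R) (u : nat -> operator V W) (f : operator V W) :
  (forall v, u n v @[n --> \oo] --> f v) ->
  exists M, forall n v, `|v| <= 1 -> `|u n v| <= M.
Proof.
move=> uf; have [|v|M uM] := @Banach_Steinhauss R V W
  [set g | exists n, g = u n :> (V -> W)] _ _ 1.
- move=> _ [n ->]; split; last exact: operator_linear.
  move=> r; have [M uM] := operator_bounded (u n); exists (`|M| * `|r|) => v vr.
  apply: (le_trans (uM v)); apply: (le_trans (ler_wpM2r _ (ler_norm M))) => //.
  by rewrite ler_wpM2l// (le_trans vr)// ler_norm.
- have /cvg_seq_bounded/pinfty_ex_gt0[M M0 uM] : cvgn (u ^~ v).
    by apply/cvg_ex; exists (f v); exact: uf.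
  by exists M => _ [n ->]; exact: uM.
- by exists M => n v v1; apply: uM => //; exists n.
Qed.

(** * A Banach space defined by bounds on functionals *)

Section GaugeSpace.
Variables (R : realType) (Z : completeNormedModType R) (g : dual Z -> R).

(** The first condition makes the least such [c] a norm that is finer than that of
    [Z]; the second one bounds the functionals [z] by the gauge [g]. Taking the
    absolute value of [g z] makes this a norm for every function [g]. *)
Definition gauge_bound (x : Z) (c : R) : Prop :=
  `|x| <= c /\ forall z : dual Z, `|operator_fun z x| <= c * `|g z|.

Definition gauge_finite : {pred Z} := mem [set x | exists c, gauge_bound x c].

Lemma gauge_boundD x y c d : gauge_bound x c -> gauge_bound y d ->
  gauge_bound (x + y) (c + d).
Proof.
move=> [xc xg] [yd yg]; split=> [|z].
  by apply: (le_trans (ler_normD _ _)); exact: lerD.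
rewrite -[operator_fun z]/(z : Z -> R^o) linearD mulrDl.
by apply: (le_trans (ler_normD _ _)); exact: lerD (xg z) (yg z).
Qed.

Lemma gauge_boundZ a x c : gauge_bound x c -> gauge_bound (a *: x) (`|a| * c).
Proof.
move=> [xc xg]; split=> [|z]; first by rewrite normrZ ler_wpM2l.
rewrite -[operator_fun z]/(z : Z -> R^o) linearZ [leLHS]normrM -mulrA.
by apply: ler_wpM2l => //; exact: xg.
Qed.

Lemma gauge_submod_closed : submod_closed gauge_finite.
Proof.
split=> [|a x y /set_mem[c xc] /set_mem[d yd]]; apply/mem_set.
  exists 0; split=> [|z]; first by rewrite normr0.
  by rewrite -[operator_fun z]/(z : Z -> R^o) linear0 normr0 mul0r.
by exists (`|a| * c + d); apply: gauge_boundD => //; exact: gauge_boundZ.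
Qed.

Record gauge_space := GaugeSpace {
  gauge_val :> Z; gauge_valP : gauge_val \in gauge_finite }.

HB.instance Definition _ := [isSub for gauge_val].
HB.instance Definition _ := [Choice of gauge_space by <:].
HB.instance Definition _ :=
  GRing.isSubmodClosed.Build R Z gauge_finite gauge_submod_closed.
HB.instance Definition _ := [SubChoice_isSubLmodule of gauge_space by <:].

Definition gauge_norm (x : gauge_space) : R := inf [set c | gauge_bound x c].

Lemma gauge_norm_le (x : gauge_space) c : gauge_bound x c -> gauge_norm x <= c.
Proof.
by move=> xc; apply: ge_inf => //; exists `|gauge_val x| => d [].
Qed.

(** The infimum is attained because the conditions on [c] are closed. *)
Lemma gauge_norm_bound (x : gauge_space) : gauge_bound x (gauge_norm x).
Proof.
have [c0 xc0] : [set c | gauge_bound x c] !=set0 by exact: (set_mem (gauge_valP x)).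
split=> [|z]; first by apply: lb_le_inf => [|c []]; first by exists c0.
have [gz0|gz0] := eqVneq (g z) 0.
  by have [_ /(_ z)] := xc0; rewrite gz0 normr0 !mulr0.
rewrite -ler_pdivrMr ?normr_gt0//; apply: lb_le_inf; first by exists c0.
by move=> c [_ /(_ z)]; rewrite ler_pdivrMr ?normr_gt0.
Qed.

Lemma gauge_normD x y : gauge_norm (x + y) <= gauge_norm x + gauge_norm y.
Proof.
by apply: gauge_norm_le; apply: gauge_boundD; exact: gauge_norm_bound.
Qed.

Lemma gauge_normZ a x : gauge_norm (a *: x) = `|a| * gauge_norm x.
Proof.
have le b y : gauge_norm (b *: y) <= `|b| * gauge_norm y.
  by apply: gauge_norm_le; apply: gauge_boundZ; exact: gauge_norm_bound.
apply/eqP; rewrite eq_le le/=; have [->|a0] := eqVneq a 0.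
  rewrite normr0 mul0r; have [+ _] := gauge_norm_bound (0 *: x).
  exact: le_trans.
rewrite -ler_pdivlMl ?normr_gt0// -normfV.
by rewrite (le_trans _ (le _ _))// scalerA mulVf// scale1r.
Qed.

Lemma gauge_norm0_eq0 x : gauge_norm x = 0 -> x = 0.
Proof.
have [+ _] := gauge_norm_bound x => /[swap] ->.
by rewrite normr_le0 => /eqP x0; exact: val_inj.
Qed.

HB.instance Definition _ := Lmodule_isNormed.Build R gauge_space
  gauge_normD gauge_normZ gauge_norm0_eq0.

(** A Cauchy filter converges in [Z], and the bounds on the differences of its elements
    pass to the limit. *)
Lemma gauge_complete (F : set_system gauge_space) :
  ProperFilter F -> cauchy F -> cvg F.
Proof.
move: F; apply: normed_complete => F FF Fc.
have [|l lF] := @cvg_of_cauchy_image R gauge_space Z F gauge_val _.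
  move=> e e0; have [x Fx] := Fc _ e0; exists x; apply: filterS Fx => y /=.
  by apply: le_trans; have [] := gauge_norm_bound (x - y).
have close e (x : gauge_space) : 0 <= e -> F [set y | `|x - y| <= e] ->
    gauge_bound (gauge_val x - l) e.
  move=> e0 Fx; have xl : (fun y : gauge_space => gauge_val x - gauge_val y) @ F
      --> gauge_val x - l by apply: cvgB => //; exact: cvg_cst.
  split=> [|z].
    apply: (cvg_norm_le xl); apply: filterS Fx => y /=.
    by apply: le_trans; have [] := gauge_norm_bound (x - y).
  have zxl : (fun y : gauge_space => (z : operator Z R^o) (gauge_val x - gauge_val y))
      @ F --> (z : operator Z R^o) (gauge_val x - l).
    by apply: continuous_cvg => //; exact: operator_continuous.
  apply: (cvg_norm_le zxl); apply: filterS Fx => y /= xy.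
  have [_ /(_ z)] := gauge_norm_bound (x - y) => /le_trans; apply.
  by rewrite ler_wpM2r.
have lfin : l \in gauge_finite.
  have [x /(close _ _ ler01)[c xl]] := Fc 1 ltr01.
  have [c' xc'] := set_mem (gauge_valP x).
  apply/mem_set; exists (c' + `|-1| * 1).
  have -> : l = gauge_val x + (-1) *: (gauge_val x - l).
    by rewrite scaleN1r opprB addrC subrK.
  by apply: gauge_boundD => //; exact: gauge_boundZ.
exists (GaugeSpace lfin) => e e0; have e20 : 0 < e / 2 by rewrite divr_gt0.
have [x Fx] := Fc _ e20; apply: filterS (Fx) => y /= xy.
have -> : GaugeSpace lfin - y = (GaugeSpace lfin - x) + (x - y).
  by rewrite addrA subrK.
apply: (le_trans (ler_normD _ _)); rewrite [e]splitr lerD//.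
rewrite -normrN opprB; apply: gauge_norm_le; exact: close (ltW e20) Fx.
Qed.

HB.instance Definition _ := Uniform_isComplete.Build gauge_space gauge_complete.

End GaugeSpace.

(** * Real powers and strong sums *)

Section PowR.
Variable R : realType.

Lemma powR_norm_continuous (a : R) : 0 < a -> continuous (fun x : R => `|x| `^ a).
Proof.
move=> a0 x; have [->|x0] := eqVneq x 0.
  rewrite /continuous_at normr0 powR0 ?gt_eqF//.
  apply/cvgrPdist_le => e e0.
  have ea0 : 0 < e `^ a^-1 by exact: powR_gt0.
  near=> y; rewrite sub0r normrN ger0_norm ?powR_ge0//.
  have ye : `|y| <= e `^ a^-1.
    by near: y; exact: (@nbhs0_le _ R^o).
  rewrite (le_trans (ge0_ler_powR (ltW a0) _ _ ye)) ?nnegrE ?powR_ge0//.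
  by rewrite -powRrM mulVf ?gt_eqF// powRr1// ltW.
have nx : 0 < `|x| by rewrite normr_gt0.
have E (y : R) : y != 0 -> `|y| `^ a = expR (a * ln `|y|).
  by move=> y0; rewrite /powR normr_eq0 (negbTE y0).
rewrite /continuous_at E//.
have : (fun y : R => expR (a * ln `|y|)) y @[y --> x] --> expR (a * ln `|x|).
  apply: continuous_cvg; first exact: continuous_expR.
  apply: cvgMr; apply: (@continuous_cvg _ _ _ _ _ (fun y : R => `|y|) (@ln R)).
    exact: continuous_ln.
  exact: norm_continuous.
apply: cvg_trans; apply: near_eq_cvg.
have : \forall y \near x, y != 0.
  by apply: (@open_nbhs_nbhs R^o); split => //; exact: open_neq.
by apply: filterS => y /= y0; rewrite E.
Unshelve. all: by end_near. Qed.

Lemma powR_powRV (s x : R) : 0 < s -> 0 <= x -> (x `^ s^-1) `^ s = x.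
Proof. by move=> s0 x0; rewrite -powRrM mulVf ?gt_eqF// powRr1. Qed.

Lemma powRV_powR (s x : R) : 0 < s -> 0 <= x -> (x `^ s) `^ s^-1 = x.
Proof. by move=> s0 x0; rewrite -powRrM mulfV ?gt_eqF// powRr1. Qed.

Lemma le_powR (s x y : R) : 0 < s -> 0 <= x -> x <= y -> x `^ s <= y `^ s.
Proof.
move=> s0 x0 xy; apply: (ge0_ler_powR (ltW s0)) => //; rewrite nnegrE//.
exact: le_trans xy.
Qed.

Lemma powRV_le (s x y : R) : 0 < s -> 0 <= x -> 0 <= y -> x <= y `^ s ->
  x `^ s^-1 <= y.
Proof.
move=> s0 x0 y0 xy; rewrite -[y](@powRV_powR s)//.
by apply: le_powR; rewrite ?invr_gt0.
Qed.

End PowR.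

Section StrongSup.
Variables (R : realType) (X Y : normedModType R) (s : R).
Hypothesis s0 : 0 < s.
Variables (n : nat) (T : 'I_n -> operator (dual X) Y).

Lemma strong_sup_has_sup : has_sup
  [set (\sum_(i < n) `|T i x| `^ s) `^ s^-1 | x in @unit_ball R (dual X)].
Proof.
split.
  exists ((\sum_(i < n) `|T i 0| `^ s) `^ s^-1), 0 => //.
  by rewrite /unit_ball/= normr0.
exists ((\sum_(i < n) `|T i| `^ s) `^ s^-1) => _ [x x1 <-].
apply: le_powR; rewrite ?invr_gt0//.
  by apply: sumr_ge0 => i _; exact: powR_ge0.
apply: ler_sum => i _; apply: le_powR => //.
by apply: (le_trans (operator_norm_le _ _)); apply: ler_piMr => //; exact: operator_norm_ge0.
Qed.

Lemma sum_le_strong_sup x : `|x| <= 1 ->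
  \sum_(i < n) `|T i x| `^ s <= strong_sup s T `^ s.
Proof.
move=> x1; have sum0 : 0 <= \sum_(i < n) `|T i x| `^ s.
  by apply: sumr_ge0 => i _; exact: powR_ge0.
rewrite -[leLHS](powR_powRV s0)//; apply: le_powR => //; first exact: powR_ge0.
by apply: ub_le_sup; [case: strong_sup_has_sup|exists x].
Qed.

Lemma strong_sup_ge0 : 0 <= strong_sup s T.
Proof.
apply: (@le_trans _ _ ((\sum_(i < n) `|T i 0| `^ s) `^ s^-1)).
  exact: powR_ge0.
apply: ub_le_sup; [by case: strong_sup_has_sup|exists 0 => //].
by rewrite /unit_ball/= normr0.
Qed.

Lemma strong_sup_powR_le c :
  (forall x, `|x| <= 1 -> \sum_(i < n) `|T i x| `^ s <= c) ->
  strong_sup s T `^ s <= c.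
Proof.
move=> Tc; have sum0 x : 0 <= \sum_(i < n) `|T i x| `^ s.
  by apply: sumr_ge0 => i _; exact: powR_ge0.
have c0 : 0 <= c by apply: le_trans (sum0 0) (Tc _ _); rewrite normr0.
rewrite -[leRHS](powR_powRV s0)//; apply: le_powR => //.
  exact: strong_sup_ge0.
apply: ge_sup; first by case: strong_sup_has_sup.
move=> _ [x x1 <-]; apply: le_powR; rewrite ?invr_gt0//; exact: Tc.
Qed.

End StrongSup.

(** * Integrals over the dual ball *)

(** The integral of a nonnegative function is the supremum of the integrals of the
    simple functions below it. Monotonicity and superadditivity follow from this
    alone, also when the integrand is measurable only for a completion. *)
Section LowerIntegral.
Context d (T : measurableType d) (R : realType).
Variable mu : {measure set T -> \bar R}.
Import HBNNSimple.
Local Open Scope ereal_scope.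

Lemma ge0_integral_mono (f g : T -> \bar R) : (forall x, 0 <= f x) ->
  (forall x, f x <= g x) -> \int[mu]_x f x <= \int[mu]_x g x.
Proof.
move=> f0 fg; rewrite !ge0_integralTE//; last by move=> x; exact: le_trans (f0 x) (fg x).
apply: ge_ereal_sup => _ [h hf <-]; apply: ereal_sup_ubound; exists h => // x.
exact: le_trans (hf x) (fg x).
Qed.

Lemma ge0_integral_superadd (f g : T -> \bar R) :
  (forall x, 0 <= f x) -> (forall x, 0 <= g x) ->
  \int[mu]_x f x \is a fin_num -> \int[mu]_x g x \is a fin_num ->
  \int[mu]_x f x + \int[mu]_x g x <= \int[mu]_x (f x + g x).
Proof.
move=> f0 g0; rewrite !ge0_integralTE//; last by move=> x; exact: adde_ge0.
move=> ffin gfin; apply/lee_addgt0Pr => e e0.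
have e20 : (0 < e / 2)%R by rewrite divr_gt0.
have [_ [h hf <-] he] := ub_ereal_sup_adherent e20 ffin.
have [_ [k kg <-] ke] := ub_ereal_sup_adherent e20 gfin.
rewrite lteBlDr// in he; rewrite lteBlDr// in ke.
apply: (le_trans (leeD (ltW he) (ltW ke))).
rewrite addeACA -EFinD -splitr leeD2r// -sintegralD.
apply: ereal_sup_ubound; exists (h \+ k)%R => // x.
by rewrite EFinD leeD.
Qed.

End LowerIntegral.

Section LowerMean.
Context d (T : measurableType d) (R : realType).
Variable mu : probability T R.

Lemma integral_bounded (f : T -> R) c : (forall x, 0 <= f x) ->
  (forall x, f x <= c) -> (\int[mu]_x (f x)%:E <= c%:E)%E.
Proof.
move=> f0 fc; apply: (@le_trans _ _ (\int[mu]_x (cst c%:E x))%E).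
  by apply: ge0_integral_mono => x; rewrite lee_fin.
by rewrite integral_cst//= -[X in (_ <= X)%E]mule1 -[X in (_ <= _ * X)%E](probability_setT mu).
Qed.

Lemma integral_bounded_fin_num (f : T -> R) c : (forall x, 0 <= f x) ->
  (forall x, f x <= c) -> (\int[mu]_x (f x)%:E \is a fin_num)%E.
Proof.
move=> f0 fc; rewrite ge0_fin_numE.
  by apply: le_lt_trans (integral_bounded f0 fc) _; rewrite ltry.
by apply: integral_ge0 => x _; rewrite lee_fin.
Qed.

Lemma sum_integral_le n (f : 'I_n -> T -> R) c : (forall i x, 0 <= f i x) ->
  (forall x, \sum_(i < n) f i x <= c) ->
  \sum_(i < n) (\int[mu]_x f i x) <= c.
Proof.
move=> f0 fc.
have fic i x : f i x <= c.
  apply: le_trans (fc x); rewrite (bigD1 i)//= lerDl sumr_ge0//.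
have fin i := integral_bounded_fin_num (f0 i) (fic i).
have subc (P : seq 'I_n) : uniq P -> forall x, \sum_(i <- P) f i x <= c.
  move=> uP x; apply: le_trans (fc x).
  rewrite big_uniq//= [leRHS](bigID (mem P))/= lerDl.
  by apply: sumr_ge0.
suff : forall P : seq 'I_n, uniq P ->
    ((\sum_(i <- P) \int[mu]_x f i x)%R%:E <= \int[mu]_x (\sum_(i <- P) f i x)%:E)%E.
  move=> /(_ (index_enum 'I_n) (index_enum_uniq _)) H.
  rewrite -lee_fin; apply: (le_trans H); apply: integral_bounded => // x.
  by apply: sumr_ge0.
elim=> [|i P IH] /= => [_|/andP[iP uP]].
  rewrite big_nil; apply: integral_ge0 => x _.
  by rewrite big_nil.
rewrite big_cons EFinD; under eq_integral do rewrite big_cons EFinD.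
apply: le_trans (ge0_integral_superadd _ _ (fin i) _); last first.
- apply: (@integral_bounded_fin_num _ c); last exact: subc.
  by move=> x; apply: sumr_ge0.
- by move=> x; rewrite lee_fin; apply: sumr_ge0.
- by move=> x; rewrite lee_fin.
by apply: leeD; [rewrite fineK//; exact: fin|exact: IH].
Qed.

End LowerMean.

Section StrongMean.
Variables (R : realType) (X Y : normedModType R) (s : R).
Hypothesis s0 : 0 < s.
Variable mu : probability (borel_ball X) R.
Implicit Type T : operator (dual X) Y.

Lemma strong_mean_ge0 T : 0 <= strong_mean s mu T.
Proof. exact: powR_ge0. Qed.

Lemma strong_mean_powR T : strong_mean s mu T `^ s =
  \int[mu]_x (`|T (ball_incl x)| `^ s).
Proof.
by rewrite powR_powRV//; apply: Rintegral_ge0 => x _; exact: powR_ge0.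
Qed.

Lemma powR_ball_le T (x : dual_ball X) : `|T (ball_incl x)| `^ s <= `|T| `^ s.
Proof.
apply: le_powR => //; apply: (le_trans (operator_norm_le _ _)).
by apply: ler_piMr; [exact: operator_norm_ge0|exact: ball_incl_le1].
Qed.

Lemma sum_strong_mean_le n (T : 'I_n -> operator (dual X) Y) :
  \sum_(i < n) strong_mean s mu (T i) `^ s <= strong_sup s T `^ s.
Proof.
under eq_bigr do rewrite strong_mean_powR.
apply: sum_integral_le => [i x|x]; first exact: powR_ge0.
by apply: sum_le_strong_sup => //; exact: ball_incl_le1.
Qed.

Lemma strong_mean_le_norm T : strong_mean s mu T <= `|T|.
Proof.
apply: powRV_le => //; first by apply: Rintegral_ge0 => x _; exact: powR_ge0.
rewrite -lee_fin fineK.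
  by apply: integral_bounded => x; [exact: powR_ge0|exact: powR_ball_le].
by apply: integral_bounded_fin_num => x; [exact: powR_ge0|exact: powR_ball_le].
Qed.

Lemma eps_product_continuous T : eps_product T ->
  continuous (fun x : dual_ball X => `|T (ball_incl x)| `^ s).
Proof.
move=> Tc x.
have -> : (fun x : dual_ball X => `|T (ball_incl x)| `^ s) =
    (fun y : R => `|y| `^ s) \o (fun x : dual_ball X => `|T (ball_incl x)|).
  by apply/funext => y /=; rewrite normr_id.
apply: continuous_comp; last exact: powR_norm_continuous.
apply: (@continuous_comp _ _ _ (fun x : dual_ball X => T (ball_incl x))
  (@Num.norm R Y)); first exact: Tc.
exact: norm_continuous.
Qed.

Lemma eps_product_measurable T : eps_product T ->
  measurable_fun [set: borel_ball X] (fun x => `|T (ball_incl x)| `^ s).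
Proof. by move=> Tc; apply: open_measurable_fun; exact: eps_product_continuous. Qed.

Lemma mean_le_strong_mean (L : (dual_ball X -> R) -> R) T :
  mean L -> (forall C : set (dual_ball X), closed C -> ((L \1_C)%:E <= mu C)%E) ->
  eps_product T ->
  L (fun x => `|T (ball_incl x)| `^ s) <= strong_mean s mu T `^ s.
Proof.
move=> mL Lmu Tc; rewrite strong_mean_powR -lee_fin fineK; last first.
  by apply: integral_bounded_fin_num => x; [exact: powR_ge0|exact: powR_ball_le].
apply: mean_le_integral => //; first exact: eps_product_continuous.
by exists (`|T| `^ s) => x; rewrite ger0_norm ?powR_ge0// powR_ball_le.
Qed.

End StrongMean.

(** The continuous integrands converge pointwise, so the limit integrand is
    Borel; the sequence is bounded by the uniform boundedness principle, and
    dominated convergence applies. *)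
Lemma strong_mean_cvg (R : realType) (X Y : normedModType R) (s : R)
    (mu : probability (borel_ball X) R) (u : nat -> operator (dual X) Y)
    (T : operator (dual X) Y) : 0 < s ->
  (forall n, eps_product (u n)) -> (forall x, u n x @[n --> \oo] --> T x) ->
  strong_mean s mu (u n) @[n --> \oo] --> strong_mean s mu T.
Proof.
move=> s0 ue uT; have [M uM] := sot_cvg_bounded uT.
have M0 : 0 <= M by apply: le_trans (uM 0%N 0 _); rewrite ?normr0.
pose h (S : operator (dual X) Y) (x : borel_ball X) : R := `|S (ball_incl x)| `^ s.
have hm n : measurable_fun [set: borel_ball X] (h (u n)).
  exact: eps_product_measurable.
have hcvg x : h (u n) x @[n --> \oo] --> h T x.
  have E S : h S x = `| `|S (ball_incl x)| | `^ s by rewrite normr_id.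
  under eq_fun do rewrite E; rewrite E.
  apply: (@continuous_cvg _ _ _ _ _ (fun n => `|u n (ball_incl x)|) (fun y : R => `|y| `^ s)).
    exact: powR_norm_continuous.
  by apply: cvg_norm; exact: uT.
have hTm : measurable_fun [set: borel_ball X] (h T).
  by apply: (measurable_fun_cvg (h := fun n => h (u n))) => // x _; exact: hcvg.
have hM n x : h (u n) x <= M `^ s.
  by apply: le_powR => //; apply: uM; exact: ball_incl_le1.
have mh S : measurable_fun [set: borel_ball X] (h S) ->
    measurable_fun [set: borel_ball X] (fun x => (h S x)%:E).
  by move=> mS; exact/measurable_EFinP.
have hM' n x : (`|(h (u n) x)%:E| <= (M `^ s)%:E)%E.
  by rewrite lee_fin ger0_norm// powR_ge0.
have hcvgE x : (h (u n) x)%:E @[n --> \oo] --> (h T x)%:E.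
  by apply: cvg_EFin; [exact: nearW|exact: hcvg].
have [_ _ hI] := @dominated_convergence _ _ R mu setT measurableT
  (fun n x => (h (u n) x)%:E) (fun x => (h T x)%:E) (fun=> (M `^ s)%:E)
  (fun n => mh _ (hm n)) (mh _ hTm)
  (aeW mu (fun x _ => hcvgE x))
  (finite_measure_integrable_cst mu (M `^ s) measurableT)
  (aeW mu (fun x n _ => hM' n x)).
have fin : (\int[mu]_x (h T x)%:E \is a fin_num)%E.
  apply: (@integral_bounded_fin_num _ _ _ _ _ (`|T| `^ s)) => x.
    exact: powR_ge0.
  exact: powR_ball_le.
have IT : \int[mu]_x h (u n) x @[n --> \oo] --> \int[mu]_x h T x.
  by apply: fine_cvg; rewrite fineK.
have mE S : strong_mean s mu S = `| \int[mu]_x h S x | `^ s^-1.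
  by rewrite ger0_norm//; apply: Rintegral_ge0 => x _; exact: powR_ge0.
under eq_fun do rewrite mE; rewrite mE.
apply: (@continuous_cvg _ _ _ _ _ (fun n => \int[mu]_x h (u n) x)
  (fun y : R => `|y| `^ s^-1)) => //.
by apply: powR_norm_continuous; rewrite invr_gt0.
Qed.

(** * Inequalities of Young and Hoelder *)

Section Young.
Variables (R : realType) (p q r : R).
Hypotheses (p0 : 0 < p) (q0 : 0 < q) (r0 : 0 < r) (pqr : p^-1 + q^-1 = r^-1).

Lemma conj_weights : r / p + r / q = 1.
Proof. by rewrite -mulrDr pqr mulfV// gt_eqF. Qed.

Lemma young (x y : R) : 0 <= x -> 0 <= y ->
  (x * y) `^ r <= r / p * x `^ p + r / q * y `^ q.
Proof.
move=> x0 y0; have pr0 : 0 < p / r by exact: divr_gt0.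
have qr0 : 0 < q / r by exact: divr_gt0.
have := conjugate_powR (powR_ge0 x r) (powR_ge0 y r) pr0 qr0.
rewrite !invf_div => /(_ conj_weights).
have rK s : r * (s / r) = s by rewrite mulrC divfK// gt_eqF.
by rewrite -powRM// -!powRrM !rK [X in X + _]mulrC [X in _ + X]mulrC.
Qed.

Let young_optimal_gt0 (D a b : R) : 0 < a -> 0 < b ->
  (forall t, 0 < t -> D <= r / p * (t `^ p * a) + r / q * (t^-1 `^ q * b)) ->
  D <= a `^ (r / p) * b `^ (r / q).
Proof.
move=> a0 b0 Dt.
(* the two summands agree at this value of t *)
pose c := r / p / q * (ln b - ln a).
have powE x e : 0 < x -> x `^ e = expR (e * ln x) :> R.
  by move=> x0; rewrite /powR gt_eqF.
have := Dt (expR c) (expR_gt0 _); rewrite -expRN.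
rewrite !powE ?expR_gt0// !expRK -{1}(lnK a0) -{1}(lnK b0) -!expRD.
have pq := conj_weights.
have -> : p * c + ln a = r / p * ln a + r / q * ln b.
  rewrite -[X in _ + X = _]mul1r -pq /c; field.
  by rewrite !gt_eqF.
have -> : q * - c + ln b = r / p * ln a + r / q * ln b.
  rewrite -[X in _ + X = _]mul1r -pq /c; field.
  by rewrite !gt_eqF.
by rewrite -mulrDl pq mul1r.
Qed.

(** The infimum over [t] of the right-hand side of Young's inequality. *)
Lemma young_optimal (D a b : R) : 0 <= a -> 0 <= b ->
  (forall t, 0 < t -> D <= r / p * (t `^ p * a) + r / q * (t^-1 `^ q * b)) ->
  D <= a `^ (r / p) * b `^ (r / q).
Proof.
move=> a0 b0 Dt.
pose f e := `|a + e| `^ (r / p) * `|b + e| `^ (r / q).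
have f0 : f e @[e --> 0^'+] --> f 0.
  apply: cvg_at_right_filter; apply: cvgM.
    apply: (@continuous_cvg _ _ _ _ _ (fun e : R => a + e)
      (fun y : R => `|y| `^ (r / p))).
      by apply: powR_norm_continuous; exact: divr_gt0.
    by apply: cvgD => //; exact: cvg_cst.
  apply: (@continuous_cvg _ _ _ _ _ (fun e : R => b + e)
    (fun y : R => `|y| `^ (r / q))).
    by apply: powR_norm_continuous; exact: divr_gt0.
  by apply: cvgD => //; exact: cvg_cst.
have -> : a `^ (r / p) * b `^ (r / q) = f 0 by rewrite /f !addr0 !ger0_norm.
apply: (ler_cvg_to (cvg_cst D) f0).
near=> e; have e0 : 0 < e by [].
rewrite /f !gtr0_norm ?ltr_wpDl//; apply: young_optimal_gt0 => [||t t0].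
- by rewrite ltr_wpDl.
- by rewrite ltr_wpDl.
apply: (le_trans (Dt t t0)); apply: lerD;
  by rewrite !ler_wpM2l ?powR_ge0 ?lerDl ?(ltW e0)// divr_ge0// ltW.
Unshelve. all: by end_near. Qed.

Lemma young_optimal_powR (d K a b : R) :
  0 <= d -> 0 <= K -> 0 <= a -> 0 <= b ->
  (forall t, 0 < t -> d `^ r <=
    r / p * (t `^ p * (K * a `^ p)) + r / q * (t^-1 `^ q * (K * b `^ q))) ->
  d <= K `^ r^-1 * a * b.
Proof.
move=> d0 K0 a0 b0 /young_optimal; rewrite !mulr_ge0 ?powR_ge0// => /(_ isT isT).
have pK s : 0 < s -> s * (r / s) = r by move=> s0; rewrite mulrC divfK// gt_eqF.
rewrite !powRM ?powR_ge0// -!powRrM !pK// mulrACA -powRD; last first.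
  by rewrite conj_weights oner_eq0.
rewrite conj_weights powRr1// => dKab.
rewrite -[leLHS](powRV_powR r0)//; apply: powRV_le => //.
- exact: powR_ge0.
- by rewrite !mulr_ge0// powR_ge0.
by rewrite -mulrA powRM ?powR_ge0 ?mulr_ge0// powR_powRV// powRM.
Qed.

Lemma hoelder_sum n (a b : 'I_n -> R) :
  (forall i, 0 <= a i) -> (forall i, 0 <= b i) ->
  (\sum_(i < n) (a i * b i) `^ r) `^ r^-1 <=
  (\sum_(i < n) a i `^ p) `^ p^-1 * (\sum_(i < n) b i `^ q) `^ q^-1.
Proof.
move=> a0 b0.
have sum0 (c : 'I_n -> R) s : 0 <= \sum_(i < n) c i `^ s.
  by apply: sumr_ge0 => i _; exact: powR_ge0.
have root_powR s x : x `^ s^-1 `^ r = x `^ (r / s) by rewrite -powRrM mulrC.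
have [A0 B0] := (sum0 a p, sum0 b q).
have AB : \sum_(i < n) (a i * b i) `^ r <=
    (\sum_(i < n) a i `^ p) `^ (r / p) * (\sum_(i < n) b i `^ q) `^ (r / q).
  apply: young_optimal => // t t0; rewrite !mulr_sumr -big_split/=.
  apply: ler_sum => i _.
  have -> : a i * b i = (t * a i) * (t^-1 * b i).
    by rewrite mulrACA mulfV ?gt_eqF// mul1r.
  apply: (le_trans (young _ _)).
  - by rewrite mulr_ge0// ltW.
  - by rewrite mulr_ge0// invr_ge0 ltW.
  by rewrite !powRM ?invr_ge0// ltW.
move: AB A0 B0 (sum0 (fun i => a i * b i) r).
move: (\sum_(i < n) _) (\sum_(i < n) _) (\sum_(i < n) _) => D A B DAB A0 B0 D0.
apply: powRV_le => //; first by rewrite mulr_ge0// powR_ge0.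
by rewrite powRM ?powR_ge0// !root_powR.
Qed.

End Young.

(** * Factorization through controlled and summing operators *)

(** Integrate the sum of the integrands, which is at most its supremum. *)
Lemma controlled_summing (R : realType) (X Y U V : normedModType R)
    (j : U -> operator (dual X) Y) (s : R) (Q : operator U V) :
  0 < s -> controlled j s Q -> summing j s Q.
Proof.
move=> s0 [K K0 [mu _ Qmu]]; exists K => // n T.
apply: powRV_le => //.
- by apply: sumr_ge0 => i _; exact: powR_ge0.
- by rewrite mulr_ge0// strong_sup_ge0.
rewrite powRM ?strong_sup_ge0//.
apply: (@le_trans _ _ (\sum_(i < n) K `^ s * strong_mean s mu (j (T i)) `^ s)).
  apply: ler_sum => i _; rewrite -powRM ?strong_mean_ge0//.
  exact: le_powR (Qmu _).
rewrite -mulr_sumr ler_wpM2l ?powR_ge0//.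
exact: (sum_strong_mean_le s0 mu (j \o T)).
Qed.

Lemma adjoint_le (R : realType) (W Z : normedModType R) (S1 : operator W Z)
    (z : dual Z) (w : W) :
  `|operator_fun z (S1 w)| <= `|w| * `|adjoint S1 z|.
Proof. by rewrite mulrC; exact: (operator_norm_le (adjoint S1 z)). Qed.

(** Hoelder's inequality applied to
    [|<S1 (S2 T), z>| <= |S2 T| |adjoint S1 z|]. *)
Lemma summing_factorization_dominated (R : realType) (p q r : R)
    (X Y W Z E F : normedModType R) (j : dual Z -> operator (dual E) F)
    (U : closedSubspace (operator (dual X) Y)) (S : operator U Z)
    (S2 : operator U W) (S1 : operator W Z) :
  0 < p -> 0 < q -> 0 < r -> p^-1 + q^-1 = r^-1 ->
  summing (@subspace_val _ _ U) p S2 -> summing j q (adjoint S1) ->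
  (forall T : U, S T = S1 (S2 T)) -> dominated j p q r S.
Proof.
move=> p0 q0 r0 pqr [K K0 KS2] [M M0 MS1] SE.
exists (K * M); first exact: mulr_ge0.
move=> n T z; set a := strong_sup p _; set b := strong_sup q _.
have -> : K * M * a * b = (K * a) * (M * b) by rewrite [RHS]mulrACA mulrA.
apply: le_trans _ (ler_pM (powR_ge0 _ _) (powR_ge0 _ _) (KS2 n T) (MS1 n z)).
have H := hoelder_sum p0 q0 r0 pqr
  (fun i => normr_ge0 (S2 (T i))) (fun i => normr_ge0 (adjoint S1 (z i))).
apply: le_trans _ H; apply: le_powR; rewrite ?invr_gt0//.
  by apply: sumr_ge0 => i _; exact: powR_ge0.
apply: ler_sum => i _; apply: le_powR => //; rewrite SE.
exact: adjoint_le.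
Qed.

(** The intermediate space consists of the [w] with
    [|<w, z>| <= c * strong_mean q eta (j z)] for all [z]; it contains the range
    of [S] by assumption, and the adjoint of its inclusion into [Z] is
    controlled by construction. *)
Lemma pietsch_factorization (R : realType) (p q K : R)
    (X Y : normedModType R) (Z : completeNormedModType R) (E F : normedModType R)
    (j : dual Z -> operator (dual E) F)
    (U : closedSubspace (operator (dual X) Y)) (S : operator U Z)
    (mu : probability (borel_ball X) R) (eta : probability (borel_ball E) R) :
  0 < p -> 0 < q -> 0 <= K -> (forall z, `|j z| <= `|z|) ->
  regular_probability mu -> regular_probability eta ->
  (forall (T : U) (z : dual Z), `|operator_fun z (S T)| <=
     K * strong_mean p mu (subspace_val T) * strong_mean q eta (j z)) ->
  exists (W : completeNormedModType R) (S2 : operator U W) (S1 : operator W Z),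
    [/\ controlled (@subspace_val _ _ U) p S2,
        controlled j q (adjoint S1) & forall T : U, S T = S1 (S2 T)].
Proof.
move=> p0 q0 K0 jle rmu reta Sle.
pose g (z : dual Z) := strong_mean q eta (j z).
have SK (T : U) : gauge_bound g (S T) (K * strong_mean p mu (subspace_val T)).
  have K0' : 0 <= K * strong_mean p mu (subspace_val T).
    by rewrite mulr_ge0// strong_mean_ge0.
  split=> [|z]; last by rewrite [`|g z|]ger0_norm ?strong_mean_ge0.
  have [f [f1 fS]] := norming_functional (S T).
  rewrite -[leLHS]ger0_norm// -fS; apply: (le_trans (Sle T f)).
  apply: ler_piMr => //; apply: le_trans (strong_mean_le_norm q0 eta (j f)) _.
  exact: le_trans (jle f) f1.
have Sfin (T : U) : (S T : Z) \in gauge_finite g.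
  by apply/mem_set; exists (K * strong_mean p mu (subspace_val T)).
pose S2 (T : U) : gauge_space g := GaugeSpace (Sfin T).
have S2le (T : U) : `|S2 T| <= K * strong_mean p mu (subspace_val T).
  exact: (@gauge_norm_le R Z g (S2 T) _ (SK T)).
have S2op : S2 \in @is_operator R U (gauge_space g).
  apply: (@bounded_is_operator _ _ _ _ K) => [a x y|x].
    by apply: val_inj; exact: (operator_linear S).
  apply: (le_trans (S2le x)); rewrite ler_wpM2l//.
  exact: strong_mean_le_norm.
have S1op : (@gauge_val _ _ g : gauge_space g -> Z) \in @is_operator R _ Z.
  apply: (@bounded_is_operator _ _ _ _ 1) => [a x y|x]; first by [].
  by rewrite mul1r; case: (gauge_norm_bound x).
exists (gauge_space g), (Operator S2op), (Operator S1op); split=> //.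
  by exists K => //; exists mu.
exists 1 => //; exists eta => // z; rewrite mul1r.
apply: operator_norm_lub => w w1; have [_ /(_ z)] := gauge_norm_bound w.
rewrite [`|g z|]ger0_norm ?strong_mean_ge0// => /le_trans; apply.
by apply: ler_piMl => //; exact: strong_mean_ge0.
Qed.

(** * Pietsch domination *)

Lemma operatorZ (R : realType) (V W : normedModType R) (f : operator V W)
    (a : R) (v : V) : f (a *: v) = a *: f v.
Proof. exact: linearZ. Qed.

Section Domination.
Variables (R : realType) (p q r : R).
Hypotheses (p0 : 0 < p) (q0 : 0 < q) (r0 : 0 < r) (pqr : p^-1 + q^-1 = r^-1).
Variables (X Y Z E F : normedModType R).
Variable j : {linear dual Z -> operator (dual E) F}.
Variable U : closedSubspace (operator (dual X) Y).
Variable S : operator U Z.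

(** By how much Young's upper bound at the point [k] exceeds the [r]-th power of the
    pairing; domination only says that finite sums of these functions have a
    nonnegative supremum. *)
Definition slack (K : R) (w : U * dual Z) (k : dual_ball X * dual_ball E) : R :=
  K `^ r * (r / p * `|subspace_val w.1 (ball_incl k.1)| `^ p +
            r / q * `|j w.2 (ball_incl k.2)| `^ q) -
  `|operator_fun w.2 (S w.1)| `^ r.

Definition slack_cone (K : R) : set (dual_ball X * dual_ball E -> R) :=
  [set f | exists s : seq (U * dual Z), f = fun k => \sum_(w <- s) slack K w k].

(** [1/p + 1/q = 1/r] is the condition under which positive multiples of slack
    functions are slack functions. *)
Lemma slackZ K a w k : 0 < a -> a * slack K w k =
  slack K (a `^ p^-1 *: w.1, a `^ q^-1 *: w.2) k.
Proof.
move=> a0; have aN s : `|a `^ s| = a `^ s by rewrite ger0_norm// powR_ge0.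
have aK s : 0 < s -> (a `^ s^-1) `^ s = a by move=> s0; rewrite powR_powRV// ltW.
case: w => T z /=.
have Ej : j (a `^ q^-1 *: z) = a `^ q^-1 *: j z by exact: linearZ.
have ES : S (a `^ p^-1 *: T) = a `^ p^-1 *: S T by exact: operatorZ.
have Ez : `|operator_fun (a `^ q^-1 *: z) (a `^ p^-1 *: S T)| =
    a `^ p^-1 * a `^ q^-1 * `|operator_fun z (S T)|.
  rewrite operatorZ normrZ aN -mulrA; congr (_ * _).
  by rewrite -[LHS]/(`|a `^ q^-1 *: (z : operator Z R^o) (S T)|) normrZ aN.
rewrite /slack/= Ej ES [X in _ = _ - X `^ r](_ : _ =
  a `^ p^-1 * a `^ q^-1 * `|operator_fun z (S T)|); last exact: Ez.
rewrite [X in _ = _ * (_ * `|X| `^ p + _) - _](_ : _ =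
  a `^ p^-1 *: subspace_val T (ball_incl k.1))//.
rewrite [X in _ = _ * (_ + _ * `|X| `^ q) - _](_ : _ =
  a `^ q^-1 *: j z (ball_incl k.2))//.
rewrite !normrZ !aN -powRD; last by apply/implyP => _; rewrite gt_eqF.
rewrite pqr !powRM ?powR_ge0// !aK//; ring.
Qed.

(** Young's inequality turns the product of the two suprema into a sum; they run over
    independent variables, so this sum is a supremum over the product of the two
    balls. *)
Lemma slack_cone_sup_ge0 K : 0 <= K ->
  (forall (n : nat) (T : 'I_n -> U) (z : 'I_n -> dual Z),
      (\sum_(i < n) `|operator_fun (z i) (S (T i))| `^ r) `^ r^-1 <=
      K * strong_sup p (fun i => subspace_val (T i)) * strong_sup q (j \o z)) ->
  forall (s : seq (U * dual Z)) c,
    (forall k, \sum_(w <- s) slack K w k <= c) -> 0 <= c.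
Proof.
move=> K0 dom s c sc; pose n := size s.
pose T (i : 'I_n) : U := (nth (0, 0) s i).1.
pose z (i : 'I_n) : dual Z := (nth (0, 0) s i).2.
pose D := \sum_(i < n) `|operator_fun (z i) (S (T i))| `^ r.
have D0 : 0 <= D by apply: sumr_ge0 => i _; exact: powR_ge0.
have Kr0 : 0 <= K `^ r := powR_ge0 K r.
have rp0 : 0 < r / p := divr_gt0 r0 p0.
have rq0 : 0 < r / q := divr_gt0 r0 q0.
pose A := strong_sup p (fun i => subspace_val (T i)).
pose B := strong_sup q (j \o z).
have A0 : 0 <= A by exact: strong_sup_ge0.
have B0 : 0 <= B by exact: strong_sup_ge0.
have DAB : D <= K `^ r * (r / p * A `^ p + r / q * B `^ q).
  apply: (@le_trans _ _ (K `^ r * (A * B) `^ r)); last first.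
    by apply: ler_wpM2l => //; exact: young.
  rewrite -powRM ?mulr_ge0// mulrA -[leLHS](powR_powRV r0 D0).
  by apply: le_powR => //; [exact: powR_ge0|exact: dom].
have cP (x : dual X) (e : dual E) : `|x| <= 1 -> `|e| <= 1 ->
    K `^ r * (r / p) * (\sum_(i < n) `|subspace_val (T i) x| `^ p) +
    K `^ r * (r / q) * (\sum_(i < n) `|j (z i) e| `^ q) <= c + D.
  move=> x1 e1.
  pose k : dual_ball X * dual_ball E :=
    (exist _ (x : wstar X) (mem_set x1), exist _ (e : wstar E) (mem_set e1)).
  rewrite -lerBlDr; apply: le_trans (sc k); rewrite (big_nth (0, 0)) big_mkord.
  rewrite /slack sumrB lerD2r !mulr_sumr -big_split/=.
  by apply: ler_sum => i _; rewrite mulrDr !mulrA.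
have powR_sup_le (V W : normedModType R) (s' a d : R)
    (Q : 'I_n -> operator (dual V) W) : 0 < s' -> 0 <= a ->
    (forall x, `|x| <= 1 -> a * \sum_(i < n) `|Q i x| `^ s' <= d) ->
    a * strong_sup s' Q `^ s' <= d.
  move=> s'0; rewrite le_eqVlt => /predU1P[<-|a0] H.
    by have := H 0; rewrite !mul0r normr0; apply.
  rewrite mulrC -ler_pdivlMr//; apply: strong_sup_powR_le => // x x1.
  by rewrite ler_pdivlMr// mulrC; exact: H.
have cA (e : dual E) : `|e| <= 1 -> K `^ r * (r / p) * A `^ p <=
    c + D - K `^ r * (r / q) * (\sum_(i < n) `|j (z i) e| `^ q).
  move=> e1; apply: powR_sup_le => //; first by rewrite mulr_ge0// ltW.
  by move=> x x1; rewrite lerBrDr; exact: cP.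
have cB : K `^ r * (r / q) * B `^ q <= c + D - K `^ r * (r / p) * A `^ p.
  apply: powR_sup_le => //; first by rewrite mulr_ge0// ltW.
  by move=> e e1; rewrite lerBrDr addrC -lerBrDr; exact: cA.
by move: DAB; rewrite mulrDr !mulrA; move: cB; lra.
Qed.

(** The two means are the marginals of one mean on the product of the dual balls. *)
Lemma dominated_mean : dominated j p q r S ->
  exists K L1 L2, [/\ 0 <= K, @mean R (dual_ball X) L1, @mean R (dual_ball E) L2 &
    forall (T : U) (z : dual Z),
      `|operator_fun z (S T)| `^ r <=
      K * (r / p * L1 (fun x => `|subspace_val T (ball_incl x)| `^ p) +
           r / q * L2 (fun e => `|j z (ball_incl e)| `^ q))].
Proof.
move=> [K K0 dom].
have bX (T : U) : fbounded (fun x : dual_ball X => `|subspace_val T (ball_incl x)| `^ p).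
  exists (`|subspace_val T| `^ p) => x; rewrite ger0_norm ?powR_ge0//.
  exact: powR_ball_le.
have bE (z : dual Z) : fbounded (fun e : dual_ball E => `|j z (ball_incl e)| `^ q).
  exists (`|j z| `^ q) => x; rewrite ger0_norm ?powR_ge0//.
  exact: powR_ball_le.
pose h1 (T : U) (k : dual_ball X * dual_ball E) :=
  `|subspace_val T (ball_incl k.1)| `^ p.
pose h2 (z : dual Z) (k : dual_ball X * dual_ball E) := `|j z (ball_incl k.2)| `^ q.
have b1 T : fbounded (h1 T) by have [M TM] := bX T; exists M => k; exact: TM.
have b2 z : fbounded (h2 z) by have [M zM] := bE z; exists M => k; exact: zM.
have slackE w : slack K w = fun k => K `^ r * (r / p) * h1 w.1 k +
    (K `^ r * (r / q) * h2 w.2 k + - `|operator_fun w.2 (S w.1)| `^ r).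
  by apply/funext => k; rewrite /slack mulrDr !mulrA addrA.
have bs w : fbounded (slack K w).
  rewrite slackE; apply: fboundedD => //; apply: fboundedD => //.
  exact: fbounded_cst.
have [||||| L [mL L0]] := @mean_ge0_cone R (dual_ball X * dual_ball E)%type
    (slack_cone K) (point, point).
- move=> _ [s ->]; elim: s => [|w s IH].
    by under eq_fun do rewrite big_nil; exact: fbounded_cst.
  under eq_fun do rewrite big_cons -[X in X + _]mul1r.
  exact: fboundedD.
- by exists [::]; apply/funext => k; rewrite big_nil.
- by move=> f g [s ->] [t ->]; exists (s ++ t); apply/funext => k; rewrite big_cat.
- move=> a f a0 [s ->].
  exists [seq (a `^ p^-1 *: w.1, a `^ q^-1 *: w.2) | w <- s].
  apply/funext => k; rewrite big_map mulr_sumr; apply: eq_bigr => w _.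
  exact: slackZ.
- by move=> f c [s ->]; exact: slack_cone_sup_ge0 K0 dom s c.
exists (K `^ r), (fun f => L (f \o fst)), (fun f => L (f \o snd)).
split; [exact: powR_ge0|exact: mean_comp|exact: mean_comp|].
move=> T z; have /L0 : slack_cone K (slack K (T, z)).
  by exists [:: (T, z)]; apply/funext => k; rewrite big_seq1.
rewrite slackE; have [_ LD _] := mL; rewrite !LD//; last 2 first.
- exact: fbounded_cst.
- by apply: fboundedD => //; exact: fbounded_cst.
by rewrite (mean_cst mL) mulrDr !mulrA/= addrA subr_ge0.
Qed.
End Domination.

Lemma dual_ball_radon_majorant (R : realType) (X : normedModType R)
    (L : (dual_ball X -> R) -> R) : mean L ->
  exists2 mu : probability (borel_ball X) R, regular_probability mu &
    forall C : set (dual_ball X), closed C -> ((L \1_C)%:E <= mu C)%E.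
Proof.
move=> mL; have [mu [rmu Lmu]] := radon_majorant (@dual_ball_hausdorff R X)
  (@dual_ball_compact R X) (mean_fap mL).
by exists mu.
Qed.

(** Replacing [T] and [z] by [t T] and [t^-1 z] does not change the left-hand side of
    the averaged inequality; optimizing over [t] turns the sum into a product. *)
Lemma pietsch_domination (R : realType) (p q r : R)
    (X Y Z E F : normedModType R) (j : {linear dual Z -> operator (dual E) F})
    (U : closedSubspace (operator (dual X) Y)) (S : operator U Z) :
  0 < p -> 0 < q -> 0 < r -> p^-1 + q^-1 = r^-1 -> dominated j p q r S ->
  exists2 K : R, 0 <= K &
    exists (mu : probability (borel_ball X) R)
           (eta : probability (borel_ball E) R),
    [/\ regular_probability mu, regular_probability eta &
     forall T : U, eps_product (subspace_val T) ->
     forall z : dual Z, eps_product (j z) ->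
       `|operator_fun z (S T)| <=
         K * strong_mean p mu (subspace_val T) * strong_mean q eta (j z)].
Proof.
move=> p0 q0 r0 pqr dom.
have [K [L1 [L2 [K0 mL1 mL2 domL]]]] := dominated_mean p0 q0 r0 pqr dom.
have [mu rmu L1mu] := dual_ball_radon_majorant mL1.
have [eta reta L2eta] := dual_ball_radon_majorant mL2.
exists (K `^ r^-1); first exact: powR_ge0.
exists mu, eta; split=> // T Te z ze.
set a := strong_mean p mu _; set b := strong_mean q eta _.
have a0 : 0 <= a := strong_mean_ge0 p mu _.
have b0 : 0 <= b := strong_mean_ge0 q eta _.
have L1a : L1 (fun x => `|subspace_val T (ball_incl x)| `^ p) <= a `^ p.
  exact: mean_le_strong_mean.
have L2b : L2 (fun e => `|j z (ball_incl e)| `^ q) <= b `^ q.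
  exact: mean_le_strong_mean.
have homog (V' W : normedModType R) (L : (dual_ball V' -> R) -> R) s t
    (Q : operator (dual V') W) : mean L -> 0 < s -> 0 < t ->
    L (fun x => `|(t *: Q) (ball_incl x)| `^ s) =
    t `^ s * L (fun x => `|Q (ball_incl x)| `^ s).
  move=> mL s0 t0; rewrite -(meanZ mL); last first.
    exists (`|Q| `^ s) => x; rewrite ger0_norm ?powR_ge0//.
    exact: powR_ball_le.
  congr L; apply/funext => x; rewrite -[(t *: Q) _]/(t *: Q _).
  by rewrite normrZ gtr0_norm// powRM// ltW.
have D_le t : 0 < t -> `|operator_fun z (S T)| `^ r <=
    r / p * (t `^ p * (K * a `^ p)) + r / q * (t^-1 `^ q * (K * b `^ q)).
  move=> t0; have t'0 : 0 < t^-1 by rewrite invr_gt0.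
  have -> : `|operator_fun z (S T)| = `|operator_fun (t^-1 *: z) (S (t *: T))|.
    rewrite -[RHS]/(`|t^-1 *: (z : operator Z R^o) (S (t *: T))|) !operatorZ.
    by rewrite scalerA mulVf ?gt_eqF// scale1r.
  apply: (le_trans (domL (t *: T) (t^-1 *: z))).
  have -> : j (t^-1 *: z) = t^-1 *: j z by exact: linearZ.
  rewrite [X in _ * (_ * X + _)](_ : _ =
    t `^ p * L1 (fun x => `|subspace_val T (ball_incl x)| `^ p)); last exact: homog.
  rewrite [X in _ * (_ + _ * X)](_ : _ =
    t^-1 `^ q * L2 (fun e => `|j z (ball_incl e)| `^ q)); last exact: homog.
  rewrite mulrDr; apply: lerD; rewrite mulrCA.
    apply: ler_wpM2l; first by rewrite divr_ge0// ltW.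
    rewrite mulrCA; apply: ler_wpM2l; first exact: powR_ge0.
    exact: (ler_wpM2l K0 L1a).
  apply: ler_wpM2l; first by rewrite divr_ge0// ltW.
  rewrite mulrCA; apply: ler_wpM2l; first exact: powR_ge0.
  exact: (ler_wpM2l K0 L2b).
exact: (young_optimal_powR p0 q0 r0 pqr _ K0 a0 b0 D_le).
Qed.

(** [T] and [j z] are sequential limits of elements to which the hypothesis
    applies; the two limits are taken one after the other. *)
Lemma domination_sot_limit (R : realType) (p q K : R)
    (X Y E F Z : normedModType R) (j : dual Z -> operator (dual E) F)
    (U : closedSubspace (operator (dual X) Y)) (S : operator U Z)
    (mu : probability (borel_ball X) R) (eta : probability (borel_ball E) R) :
  0 < p -> 0 < q ->
  sot_seq_continuous j (id : dual Z -> wstar Z) ->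
  sot_seq_dense (range j `&` @eps_product R E F) (range j) ->
  sot_seq_dense (subspace_set U `&` @eps_product R X Y) (subspace_set U) ->
  sot_seq_continuous (@subspace_val _ _ U) S ->
  (forall T : U, eps_product (subspace_val T) ->
   forall z : dual Z, eps_product (j z) ->
     `|operator_fun z (S T)| <=
       K * strong_mean p mu (subspace_val T) * strong_mean q eta (j z)) ->
  forall (T : U) (z : dual Z), `|operator_fun z (S T)| <=
    K * strong_mean p mu (subspace_val T) * strong_mean q eta (j z).
Proof.
move=> p0 q0 idc jd Ud Sc le_eps.
have step1 (T : U) (z : dual Z) : eps_product (subspace_val T) ->
    `|operator_fun z (S T)| <=
    K * strong_mean p mu (subspace_val T) * strong_mean q eta (j z).
  move=> Te; have [|u ujE uz] := jd (j z); first by exists z.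
  have /choice[w wu] n : exists w, j w = u n by have [[w _ <-] _] := ujE n; exists w.
  have {}uz : (j (w n) : sot (dual E) F) @[n --> \oo] --> (j z : sot (dual E) F).
    by under eq_fun do rewrite wu.
  have /sot_cvgP wz := idc w z uz; have /sot_cvgP jwz := uz.
  have we n : eps_product (j (w n)) by rewrite wu; case: (ujE n).
  have lhs : `|operator_fun (w n) (S T)| @[n --> \oo] --> `|operator_fun z (S T)|.
    by apply: cvg_norm; exact: wz.
  have rhs : K * strong_mean p mu (subspace_val T) * strong_mean q eta (j (w n))
      @[n --> \oo] --> K * strong_mean p mu (subspace_val T) * strong_mean q eta (j z).
    by apply: cvgMr; apply: strong_mean_cvg.
  by apply: (ler_cvg_to lhs rhs); apply: nearW => n; exact: le_eps.
move=> T z; have [|u uUE uT] := Ud (subspace_val T).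
  exact: (set_mem (subspace_valP T)).
have uU n : u n \in subspace_pred U by apply/mem_set; case: (uUE n).
pose w n : U := SubspaceSort (uU n).
have ST : S (w n) @[n --> \oo] --> S T by exact: Sc.
have /sot_cvgP uTp := uT.
have lhs : `|operator_fun z (S (w n))| @[n --> \oo] --> `|operator_fun z (S T)|.
  apply: cvg_norm; apply: (@continuous_cvg _ _ _ _ _ (fun n => S (w n))
    (operator_fun z)) => //; exact: operator_continuous.
have rhs : K * strong_mean p mu (u n) * strong_mean q eta (j z)
    @[n --> \oo] --> K * strong_mean p mu (subspace_val T) * strong_mean q eta (j z).
  apply: cvgMl; apply: cvgMr; apply: strong_mean_cvg => // n.
  by case: (uUE n).
apply: (ler_cvg_to lhs rhs); apply: nearW => n.
by apply: (step1 (w n)); case: (uUE n).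
Qed.

Theorem theorem3p2 (R : realType) (p q r : R)
  (p1 : 1 < p) (q1 : 1 < q) (pq1 : p^-1 + q^-1 <= 1)
  (r1 : 1 <= r) (pqr : p^-1 + q^-1 = r^-1)
  (X Y Z E F : completeNormedModType R)
  (j : {linear dual Z -> operator (dual E) F})
  (j_isometry : forall z : dual Z, `|j z| = `|z|)
  (j_UM : range j `<=` @UM R E F)
  (U : closedSubspace (operator (dual X) Y))
  (U_UM : subspace_set U `<=` @UM R X Y)
  (S : operator U Z) :
  let i := dominated j p q r S in
  let ii := exists2 K : R, 0 <= K &
    exists (mu : probability (borel_ball X) R)
           (eta : probability (borel_ball E) R),
    [/\ regular_probability mu, regular_probability eta &
     forall T : U, eps_product (subspace_val T) ->
     forall z : dual Z, eps_product (j z) ->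
       `|operator_fun z (S T)| <=
         K * strong_mean p mu (subspace_val T) * strong_mean q eta (j z)] in
  let iii := exists2 K : R, 0 <= K &
    exists (mu : probability (borel_ball X) R)
           (eta : probability (borel_ball E) R),
    [/\ regular_probability mu, regular_probability eta &
     forall (T : U) (z : dual Z),
       `|operator_fun z (S T)| <=
         K * strong_mean p mu (subspace_val T) * strong_mean q eta (j z)] in
  let iv := exists (W : completeNormedModType R)
                   (S2 : operator U W) (S1 : operator W Z),
    [/\ controlled (@subspace_val _ _ U) p S2,
        controlled j q (adjoint S1) & forall T : U, S T = S1 (S2 T)] in
  let v := exists (W : completeNormedModType R)
                  (S2 : operator U W) (S1 : operator W Z),
    [/\ summing (@subspace_val _ _ U) p S2,
        summing j q (adjoint S1) & forall T : U, S T = S1 (S2 T)] in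
  [/\ iii -> iv, iv -> v, v -> i & i -> ii] /\
  (sot_seq_continuous j (id : dual Z -> wstar Z) ->
   sot_seq_dense (range j `&` @eps_product R E F) (range j) ->
   sot_seq_dense (subspace_set U `&` @eps_product R X Y) (subspace_set U) ->
   sot_seq_continuous (@subspace_val _ _ U) S ->
   [<-> i; ii; iii; iv; v]).
Proof.
move=> i ii iii iv v.
have p0 : 0 < p by exact: lt_trans p1.
have q0 : 0 < q by exact: lt_trans q1.
have r0 : 0 < r by exact: lt_le_trans r1.
have iii_iv : iii -> iv.
  move=> [K K0 [mu [eta [rmu reta le_K]]]].
  apply: (pietsch_factorization p0 q0 K0 _ rmu reta le_K) => z.
  by rewrite j_isometry.
have iv_v : iv -> v.
  move=> [W [S2 [S1 [cS2 cS1 SE]]]]; exists W, S2, S1.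
  by split=> //; exact: controlled_summing.
have v_i : v -> i.
  move=> [W [S2 [S1 [sS2 sS1 SE]]]].
  exact: summing_factorization_dominated sS2 sS1 SE.
have i_ii : i -> ii by exact: pietsch_domination.
split=> // idc jd Ud Sc; tfae=> //.
move=> [K K0 [mu [eta [rmu reta le_eps]]]].
exists K => //; exists mu, eta; split=> //.
exact: domination_sot_limit le_eps.
Qed.
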